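(* Let $\Omega\subset\mathbb{R}^n$ ($n\ge3$) be a 2-sided locally NTA domain such that $\mathcal{H}^{n-1}\llcorner\partial\Omega$ is a Radon measure. Let $\Gamma^\ast$, $S$, $N$ be as defined in the context. Then $\partial\Omega=\Gamma^\ast\cup S\cup N$ and $\Gamma^\ast$ is $(n-1)$-rectifiable.
   Context: Domains. For a domain $\Omega\subset\mathbb{R}^n$ put $\Omega^+=\Omega$ and $\Omega^-=\mathrm{int}(\mathbb{R}^n\setminus\Omega)$. Corkscrew condition: an open set $\Omega$ satisfies it if for each compact $K\subset\mathbb{R}^n$ there exist $M>1$ and $R>0$ such that for all $Q\in\partial\Omega\cap K$ and $r\in(0,R]$ there is $A=A(Q,r)\in\Omega$ with $M^{-1}r<|A-Q|<r$ and $d(A,\partial\Omega)>M^{-1}r$; if $\Omega$ is unbounded one requires $R=\infty$. Locally NTA (non-tangentially accessible): $\Omega$ is locally NTA if (1) $\Omega^+$ and $\Omega^-$ satisfy the corkscrew condition, and (2) (Harnack chain condition) for each compact $K\subset\mathbb{R}^n$ there exist $R=R_K>0$, $M=M_K>1$ such that if $\epsilon>0$, $k\in\mathbb{N}$, $Q\in\partial\Omega\cap K$, $r<R$, $X_1,X_2\in\Omega\cap B(Q,r/4)$, $d(X_j,\partial\Omega)>\epsilon$ for $j=1,2$ and $|X_1-X_2|<2^k\epsilon$, then there is a Harnack chain from $X_1$ to $X_2$ of length $Mk$, the diameter of each ball being bounded below by $M^{-1}\min\{\mathrm{dist}(X_1,\partial\Omega),\mathrm{dist}(X_2,\partial\Omega)\}$;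 if $\Omega$ is unbounded one requires $R=\infty$. (A Harnack chain is a finite sequence of balls in $\Omega$, the first containing $X_1$, the last containing $X_2$, consecutive balls intersecting, and each ball $B$ having diameter comparable, with constant $M$, to its distance to $\partial\Omega$.) $\Omega$ is 2-sided locally NTA if $\Omega^+$ and $\Omega^-$ are both locally NTA domains. Harmonic measures. Fix $X^\pm\in\Omega^\pm$; $\omega^\pm$ denotes the harmonic measure of $\Omega^\pm$ with pole $X^\pm$, a Radon measure carried by $\partial\Omega$. For $Q\in\partial\Omega$ consider $\lim_{r\to0}\frac{\omega^-(B(Q,r))}{\omega^+(B(Q,r))}$, denoted $h(Q)=\frac{d\omega^-}{d\omega^+}(Q)$ where it exists and is finite. Let $\Lambda_1$ be the set of $Q\in\partial\Omega$ where the limit exists and lies in $(0,\infty)$, $\Lambda_2$ the set where it is $\infty$, $\Lambda_3$ the set where it is $0$, $\Lambda_4$ the set where it does not exist. Let $$\Gamma=\Big\{Q\in\Lambda_1:\ h(Q)=\lim_{r\to0}\tfrac{1}{\omega^+(B(Q,r))}\int_{B(Q,r)}h\,d\omega^+,\ \ \lim_{r\to0}\tfrac{1}{\omega^+(B(Q,r))}\int_{B(Q,r)}|h(P)-h(Q)|\,d\omega^+(P)=0\Big\}.$$ Tangent measures. For a Radon measure $\eta$ on $\mathbb{R}^n$ let $T_{x,r}(z)=(z-x)/r$ and $T_{x,r}[\eta](E)=\eta(x+rE)$. $\mathrm{Tan}(\eta,x)$ is the set of non-zero Radon measures $\nu$ for which there are $r_k\searrow0$ and $c_k>0$ with $c_kT_{x,r_k}[\eta]\to\nu$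 weakly. $\mathcal{F}=\{c\,\mathcal{H}^{n-1}\llcorner V:\ c\in(0,\infty),\ V\in G(n,n-1)\}$, where $G(n,n-1)$ is the set of $(n-1)$-dimensional linear subspaces. Define $\Gamma^\ast=\{Q\in\Gamma:\ \mathrm{Tan}(\omega^\pm,Q)\cap\mathcal{F}\neq\emptyset\}$ (for $Q\in\Gamma$, $\mathrm{Tan}(\omega^+,Q)=\mathrm{Tan}(\omega^-,Q)$, so the sign is immaterial), $S=\Lambda_2\cup\Lambda_3$, $N=(\Lambda_1\setminus\Gamma^\ast)\cup\Lambda_4$. A set $E\subset\mathbb{R}^n$ is $(n-1)$-rectifiable if there are countably many Lipschitz maps $f_i:\mathbb{R}^{n-1}\to\mathbb{R}^n$ with $\mathcal{H}^{n-1}(E\setminus\bigcup_if_i(\mathbb{R}^{n-1}))=0$. $\mu\llcorner E$ is the restriction of $\mu$ to $E$. *)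

(* Defs.v *)
From HB Require Import structures.
From mathcomp Require Import all_boot all_order all_algebra.
From mathcomp Require Import all_classical all_reals all_analysis.

Set Implicit Arguments.
Unset Strict Implicit.
Unset Printing Implicit Defensive.

Import Order.TTheory GRing.Theory Num.Theory.
Import numFieldNormedType.Exports.

Local Open Scope classical_set_scope.
Local Open Scope ring_scope.

(** ** Euclidean geometry of ['rV[R]_n]

  The norm of ['rV[R]_n] in the library is the sup norm.  It induces the right
  topology (so [open], [compact], [connected], [continuous], [bounded_set] and
  the derivatives are the library's), but balls, distances and diameters below
  are Euclidean, since the limits of ratios of measures of balls and the
  Hausdorff measure depend on the metric and not only on the topology. *)

Section Euclidean.
Variables (R : realType) (n : nat).
Implicit Types (x y : 'rV[R]_n) (A B : set 'rV[R]_n).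

Definition enorm x : R := Num.sqrt (\sum_(i < n) x ord0 i ^+ 2).

Definition eball x (r : R) : set 'rV[R]_n := [set y | enorm (y - x) < r].

Definition closed_eball x (r : R) : set 'rV[R]_n :=
  [set y | enorm (y - x) <= r].

Definition set_dist A B : R := inf [set enorm (x - y) | x in A & y in B].

(* The point 0 is added so that the diameter of the empty set is 0. *)
Definition ediam A : \bar R :=
  ereal_sup (0%E |` [set (enorm (x - y))%:E | x in A & y in A]).

Definition boundary A : set 'rV[R]_n := closure A `\` interior A.

Definition exterior A : set 'rV[R]_n := interior (~` A).

Definition domain A : Prop := [/\ open A, connected A & A !=set0].

End Euclidean.

(** ** Non-tangentially accessible domains *)

Section NTA.
Variables (R : realType) (n : nat).
Implicit Types (Omega K : set 'rV[R]_n).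

Definition corkscrew Omega : Prop :=
  forall K, compact K ->
  exists (M : R) (R0 : \bar R),
    [/\ 1 < M, (0 < R0)%E, (~ bounded_set Omega -> R0 = +oo%E) &
      forall Q r, boundary Omega Q -> K Q -> 0 < r -> (r%:E <= R0)%E ->
      exists2 A, Omega A &
        [/\ M^-1 * r < enorm (A - Q), enorm (A - Q) < r &
            M^-1 * r < set_dist [set A] (boundary Omega)]].

(* The balls of the chain are [eball (c i) (rho i)] for [i < m]. *)
Definition harnack_chain Omega (M : R) (X1 X2 : 'rV[R]_n) (m : nat)
    (c : nat -> 'rV[R]_n) (rho : nat -> R) : Prop :=
  let B i := eball (c i) (rho i) in
  [/\ (0 < m)%N,
      forall i, (i < m)%N ->
        [/\ 0 < rho i, B i `<=` Omega,
            ((M^-1 * set_dist (B i) (boundary Omega))%:E <= ediam (B i))%E &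
            (ediam (B i) <= (M * set_dist (B i) (boundary Omega))%:E)%E],
      B 0%N X1,
      B m.-1 X2 &
      forall i, (i.+1 < m)%N -> B i `&` B i.+1 !=set0].

(* The index [k] is positive: a chain of length [M * 0] would be empty.  The
   real number [M * k] bounds the length; a shorter chain can be lengthened by
   repeating a ball. *)
Definition harnack_chain_condition Omega : Prop :=
  forall K, compact K ->
  exists (M : R) (R0 : \bar R),
    [/\ 1 < M, (0 < R0)%E, (~ bounded_set Omega -> R0 = +oo%E) &
      forall (eps : R) (k : nat) Q (r : R) X1 X2,
        0 < eps -> (0 < k)%N -> boundary Omega Q -> K Q ->
        0 < r -> (r%:E < R0)%E ->
        Omega X1 -> eball Q (r / 4) X1 -> Omega X2 -> eball Q (r / 4) X2 ->
        let d X := set_dist [set X] (boundary Omega) in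
        eps < d X1 -> eps < d X2 -> enorm (X1 - X2) < 2 ^+ k * eps ->
        exists m c rho,
          [/\ harnack_chain Omega M X1 X2 m c rho,
              m%:R <= M * k%:R &
              forall i, (i < m)%N ->
                ((M^-1 * Num.min (d X1) (d X2))%:E
                   <= ediam (eball (c i) (rho i)))%E]].

Definition locally_NTA_domain Omega : Prop :=
  [/\ domain Omega, corkscrew Omega, corkscrew (exterior Omega) &
      harnack_chain_condition Omega].

Definition two_sided_locally_NTA_domain Omega : Prop :=
  locally_NTA_domain Omega /\ locally_NTA_domain (exterior Omega).

End NTA.

(** ** Borel, Radon and Hausdorff measures *)

HB.instance Definition _ (R : realType) (m n : nat) :=
  @isMeasurable.Build (sigma_display (@open 'M[R]_(m, n))) 'M[R]_(m, n)
    <<s @open 'M[R]_(m, n) >> (@sigma_algebra0 _ setT _) (@sigma_algebraC _ _)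
    (@sigma_algebra_bigcup _ setT _).

Section Measures.
Variables (R : realType) (n : nat).
Local Notation T := 'rV[R]_n.

(* Stated for set functions, so that it applies both to measures of the library
   and to restrictions of the Hausdorff measure. *)
Definition radon (mu : set T -> \bar R) : Prop :=
  [/\ mu set0 = 0%E /\ (forall A, measurable A -> 0 <= mu A)%E,
      semi_sigma_additive mu,
      (forall K, compact K -> mu K < +oo)%E,
      (forall U, open U ->
         mu U = ereal_sup [set mu K | K in [set K | compact K /\ K `<=` U]]) &
      (forall A, measurable A ->
         mu A = ereal_inf [set mu U | U in [set U | open U /\ A `<=` U]])].

(* The Hausdorff measure of dimension [s > 0], without the volume of the unit
   ball as normalising factor.  It is only used up to a positive factor: for
   being Radon, for null sets and for all the positive multiples of it. *)
Definition hausdorff_pre (s : nat) (delta : R) (A : set T) : \bar R :=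
  ereal_inf [set (\sum_(0 <= k <oo) ediam (C k) ^+ s)%E | C in
    [set C : nat -> set T | A `<=` \bigcup_k C k /\
                            forall k, (ediam (C k) <= delta%:E)%E]].

Definition hausdorff (s : nat) (A : set T) : \bar R :=
  ereal_sup [set hausdorff_pre s delta A | delta in [set delta | 0 < delta]].

Definition mrestriction (mu : set T -> \bar R) (A E : set T) : \bar R :=
  mu (E `&` A).

Definition rectifiable (s : nat) (E : set T) : Prop :=
  exists f : nat -> 'rV[R]_s -> T,
    (forall i, exists L : R, forall x y,
       enorm (f i x - f i y) <= L * enorm (x - y)) /\
    hausdorff s (E `\` \bigcup_i range (f i)) = 0%E.

Definition Cc (phi : T -> R) : Prop :=
  continuous phi /\ compact (closure [set x | phi x != 0]).

End Measures.

(** ** Harmonic measure *)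

Section HarmonicMeasure.
Variables (R : realType) (n : nat).
Local Notation T := 'rV[R]_n.
Implicit Types (U Omega : set T) (u v h f : T -> R).

Definition partial (i : 'I_n) u : T -> R := 'D_(delta_mx ord0 i) u.

Definition C0_on U u : Prop := forall x, U x -> {for x, continuous u}.

Definition C1_on U u : Prop :=
  C0_on U u /\
  forall i, (forall x, U x -> derivable u x (delta_mx ord0 i)) /\
            C0_on U (partial i u).

Definition C2_on U u : Prop :=
  C1_on U u /\ forall i, C1_on U (partial i u).

Definition harmonic_on U u : Prop :=
  C2_on U u /\ forall x, U x -> \sum_(i < n) partial i (partial i u) x = 0.

(* Continuous functions below the harmonic functions that dominate them on the
   boundary of a ball, as in the classical presentation of Perron's method. *)
Definition subharmonic_on U v : Prop :=
  C0_on U v /\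
  forall c r h, 0 < r -> closed_eball c r `<=` U ->
    {within closed_eball c r, continuous h} -> harmonic_on (eball c r) h ->
    (forall x, enorm (x - c) = r -> v x <= h x) ->
    forall x, eball c r x -> v x <= h x.

(* The last condition is the boundary condition 0 at infinity, which is void
   if [Omega] is bounded. *)
Definition perron_family Omega f : set (T -> R) :=
  [set v | [/\ subharmonic_on Omega v,
    (forall z, boundary Omega z -> forall eps, 0 < eps ->
       \forall x \near z, Omega x -> v x <= f z + eps) &
    (forall eps, 0 < eps ->
       exists r, forall x, Omega x -> r < enorm x -> v x <= eps)]].

Definition perron_solution Omega f (X : T) : R :=
  sup [set v X | v in perron_family Omega f].

(* [w] represents the functional that sends a compactly supported boundary
   value to the value at [X] of the Perron solution; since [w] is carried by the
   boundary of [Omega], only the values of [f] there matter. *)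
Definition is_harmonic_measure Omega (X : T)
    (w : {measure set T -> \bar R}) : Prop :=
  [/\ radon w, w (~` boundary Omega) = 0%E &
      forall f, Cc f ->
        (\int[w]_x (f x)%:E = (perron_solution Omega f X)%:E)%E].

End HarmonicMeasure.

(** ** Tangent measures *)

Section TangentMeasures.
Variables (R : realType) (n : nat).
Local Notation T := 'rV[R]_n.

Definition zoom (x : T) (r : R) (z : T) : T := r^-1 *: (z - x).

Lemma measurable_zoom x r : measurable_fun [set: T] (zoom x r).
Proof.
have czoom : continuous (zoom x r).
  move=> z; have F := nbhs_filter z.
  apply: (@cvgZl_tmp _ _ _ (nbhs z) F r^-1 (fun z => z - x)).
  by apply: (@cvgB _ _ _ (nbhs z) F id (fun=> x));
    [exact: cvg_id | exact: cvg_cst].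
apply: (@measurability _ _ _ _ setT (zoom x r) (@open T)) => //.
move=> _ [U oU <-]; rewrite setTI; apply: sub_sigma_algebra.
by apply: open_comp => // z _; exact: czoom.
Qed.

(* [zoom x r @^-1` E] is [x + r E]. *)
Definition blowup (eta : {measure set T -> \bar R}) (x : T) (r : R) :
  set T -> \bar R := pushforward eta (zoom x r).

Let blowup_measure eta x r : {measure set T -> \bar R} :=
  measure_function_pushforward__canonical__measure_function_Measure
    eta (measurable_zoom x r).

HB.instance Definition _ eta x r := isMeasure.Build _ _ _ (blowup eta x r)
  (measure0 (blowup_measure eta x r)) (measure_ge0 (blowup_measure eta x r))
  (@measure_semi_sigma_additive _ _ _ (blowup_measure eta x r)).

Definition weakly_converges (mu : nat -> {measure set T -> \bar R})
    (nu : {measure set T -> \bar R}) : Prop :=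
  forall phi, Cc phi ->
    (\int[mu k]_z (phi z)%:E)%E @[k --> \oo] --> (\int[nu]_z (phi z)%:E)%E.

Definition Tan (eta : {measure set T -> \bar R}) (x : T) :
    set {measure set T -> \bar R} :=
  [set nu : {measure set T -> \bar R} | [/\ radon nu, nu [set: T] <> 0%E &
    exists (r c : nat -> {posnum R}),
      [/\ nonincreasing_seq (fun k => (r k)%:num),
          (r k)%:num @[k --> \oo] --> (0 : R) &
          weakly_converges
            (fun k => mscale (c k)%:num%:nng (blowup eta x (r k)%:num)) nu]]].

(* A measure of the library is only constrained on measurable sets. *)
Definition flat : set {measure set T -> \bar R} :=
  [set nu : {measure set T -> \bar R} | exists (c : R) (V : {vspace T}),
    [/\ 0 < c, \dim V = n.-1 & forall E, measurable E ->
      nu E = (c%:E * mrestriction (hausdorff n.-1) [set` V] E)%E]].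

End TangentMeasures.

(** ** The decomposition of the boundary *)

Section Decomposition.
Variables (R : realType) (n : nat).
Local Notation T := 'rV[R]_n.
Variables (Omega : set T) (wp wm : {measure set T -> \bar R}).

Definition ratio (Q : T) (r : R) : \bar R :=
  (wm (eball Q r) / wp (eball Q r))%E.

(* The derivative [h] of [wm] with respect to [wp] where it exists and is
   finite, and 0 elsewhere. *)
Definition density (Q : T) : R :=
  xget 0 [set l : R | ratio Q r @[r --> 0^'+] --> l%:E].

Definition Lambda1 : set T :=
  [set Q | boundary Omega Q /\
           exists2 l : R, 0 < l & ratio Q r @[r --> 0^'+] --> l%:E].

Definition Lambda2 : set T :=
  [set Q | boundary Omega Q /\ ratio Q r @[r --> 0^'+] --> +oo%E].

Definition Lambda3 : set T :=
  [set Q | boundary Omega Q /\ ratio Q r @[r --> 0^'+] --> 0%E].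

Definition Lambda4 : set T :=
  [set Q | boundary Omega Q /\
           ~ exists l : \bar R, ratio Q r @[r --> 0^'+] --> l].

Definition average (g : T -> R) (Q : T) (r : R) : \bar R :=
  ((wp (eball Q r))^-1 * \int[wp]_(P in eball Q r) (g P)%:E)%E.

Definition Gamma : set T :=
  [set Q | [/\ Lambda1 Q,
    average density Q r @[r --> 0^'+] --> (density Q)%:E &
    average (fun P => `|density P - density Q|) Q r @[r --> 0^'+] --> 0%E]].

(* At the points of [Gamma] the measures [wp] and [wm] have the same tangent
   measures, so that [wp] could be replaced by [wm]. *)
Definition Gamma_star : set T :=
  [set Q | Gamma Q /\ Tan wp Q `&` @flat R n !=set0].

Definition singular_part : set T := Lambda2 `|` Lambda3.

Definition null_part : set T := (Lambda1 `\` Gamma_star) `|` Lambda4.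

End Decomposition.

(* Main.v *)
(* The boundary E of the exterior domain is rectifiable, and this follows from the
   two-sided corkscrew condition and the local finiteness of H^(n-1) alone; the
   harmonic measures only serve to see that Gamma^* lies in E, because the
   exterior harmonic measure vanishes near the other points of the boundary.

   Call a point x of E accessible if, near x, some one-sided open cone with vertex
   x contains no point of E.  Accessible points lie on countably many Lipschitz
   graphs, so it suffices that almost every point of E is accessible.  Let two
   balls of radius comparable to r near x lie in U = exterior Omega and off U, and
   let e join their centres.  Every line parallel to e through the first ball has a
   last point of E before the second one.  Almost every such last point y is
   accessible.  Otherwise E has points y' in arbitrarily thin cones above y, at
   distance t, within s << t of the line through y.  The corkscrew ball of U of
   radius s near y' gives two cases.  Either all segments going down from it meet
   E at points below U: they form a set of mass s^(n-1), and this contradicts that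
   a.e. last point is a point of density zero of the part of E below U.  Or one of
   these segments stays in U while the line above y does not, so that there are
   about t/s disjoint balls of radius s, centred on E, in a tube of width s around
   the line, each of mass s^(n-1): this contradicts the a.e. finiteness of the
   density of the projection of H^(n-1) along e.  So the accessible points have
   positive lower density at every point of E, hence full measure. *)
Require Import Defs.
From HB Require Import structures.
From mathcomp Require Import all_boot all_order all_algebra.
From mathcomp Require Import all_classical all_reals all_analysis.
From mathcomp Require Import ring lra.

Set Implicit Arguments.
Unset Strict Implicit.
Unset Printing Implicit Defensive.

Import Order.TTheory GRing.Theory Num.Theory.
Import numFieldNormedType.Exports.

Local Open Scope classical_set_scope.
Local Open Scope ring_scope.

(** * The sup norm against the Euclidean norm, and Euclidean diameters *)

Section Norms.
Context {R : realType}.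

Lemma norm_coord_le (n : nat) (x : 'rV[R]_n) (j : 'I_n) : `|x ord0 j| <= `|x|.
Proof.
by rewrite [leRHS]/Num.norm /= mx_normrE; apply/bigmax_geP; right; exists (ord0, j).
Qed.

Lemma norm_le_coord (n : nat) (x : 'rV[R]_n) (r : R) :
  0 <= r -> (forall j, `|x ord0 j| <= r) -> `|x| <= r.
Proof.
move=> r0 xr; rewrite [leLHS]/Num.norm /= mx_normrE; apply/bigmax_leP; split => //.
by move=> [i j] _ /=; rewrite (ord1 i).
Qed.

Lemma norm_lt_coord (n : nat) (x : 'rV[R]_n) (r : R) :
  0 < r -> (forall j, `|x ord0 j| < r) -> `|x| < r.
Proof.
move=> r0 xr; rewrite [ltLHS]/Num.norm /= mx_normrE; apply/bigmax_ltP; split => //.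
by move=> [i j] _ /=; rewrite (ord1 i).
Qed.

Lemma norm_coord_max (n : nat) (x : 'rV[R]_n) :
  x != 0 -> exists j, `|x ord0 j| = `|x|.
Proof.
move=> x0; have [|[i j] /=] := @mx_norm_neq0 _ _ _ x;
  first by rewrite -[mx_norm x]/(`|x|) normr_eq0.
by rewrite (ord1 i) => xj; exists j; rewrite -xj.
Qed.

Lemma norm_le_enorm (n : nat) (x : 'rV[R]_n) : `|x| <= enorm x.
Proof.
apply: norm_le_coord => [|j]; first exact: sqrtr_ge0.
rewrite -sqrtr_sqr /enorm ler_sqrt ?sumr_ge0// => [|i _]; last exact: sqr_ge0.
by rewrite (bigD1 j)//= lerDl sumr_ge0// => i _; exact: sqr_ge0.
Qed.

Lemma enorm_le_norm (n : nat) (x : 'rV[R]_n) : enorm x <= n%:R * `|x|.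
Proof.
rewrite -[leRHS]ger0_norm ?mulr_ge0// -sqrtr_sqr /enorm ler_sqrt ?sqr_ge0//.
apply: (@le_trans _ _ (\sum_(i < n) `|x| ^+ 2)).
  apply: ler_sum => i _; rewrite -[leLHS]real_normK ?num_real//.
  by rewrite lerXn2r ?nnegrE ?norm_coord_le.
rewrite sumr_const card_ord -[leLHS]mulr_natl exprMn ler_wpM2r ?sqr_ge0//.
by rewrite -natrX ler_nat; case: n {x} => // n; rewrite expnS leq_pmulr// expn_gt0.
Qed.

End Norms.

Section Diameter.
Context {R : realType} {n : nat}.
Implicit Types A B : set 'rV[R]_n.

Lemma ediam_ge0 A : (0 <= ediam A)%E.
Proof. by apply: ereal_sup_ubound; left. Qed.

Lemma ediam_le A (r : R) : 0 <= r ->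
  (forall x y, A x -> A y -> enorm (x - y) <= r) -> (ediam A <= r%:E)%E.
Proof.
move=> r0 Ar; apply: ge_ereal_sup => _ [->|[x Ax [y Ay <-]]]; first by rewrite lee_fin.
by rewrite lee_fin; exact: Ar.
Qed.

Lemma le_ediam A x y : A x -> A y -> ((enorm (x - y))%:E <= ediam A)%E.
Proof. by move=> Ax Ay; apply: ereal_sup_ubound; right; exists x => //; exists y. Qed.

Lemma ediam_set0 : ediam (set0 : set 'rV[R]_n) = 0%E.
Proof. by apply/eqP; rewrite eq_le ediam_ge0 andbT; exact: ediam_le. Qed.

Lemma ediam_ball_le (x : 'rV[R]_n) (r : R) : 0 <= r ->
  (ediam (ball x r) <= (n%:R * (r *+ 2))%:E)%E.
Proof.
move=> r0; apply: ediam_le => [|y z]; first by rewrite mulr_ge0// mulrn_wge0.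
rewrite -ball_normE /= => xy xz; rewrite (le_trans (enorm_le_norm _))//.
rewrite ler_wpM2l// mulr2n (le_trans (ler_distD x y z))//.
by rewrite distrC lerD// ltW.
Qed.

End Diameter.

(** * Monotonicity and countable subadditivity of the Hausdorff measure *)

Section Hausdorff.
Context {R : realType}.

Lemma lee_expe (x y : \bar R) s : (0 <= x -> x <= y -> x ^+ s <= y ^+ s)%E.
Proof.
move=> x0 xy; elim: s => [|s IH]; rewrite ?expe0// !expeS lee_pmul//.
exact: expe_ge0.
Qed.

Lemma ediamX_ge0 n (A : set 'rV[R]_n) s : (0 <= ediam A ^+ s)%E.
Proof. exact/expe_ge0/ediam_ge0. Qed.

Context {n : nat} (s : nat).
Implicit Types A B : set 'rV[R]_n.

Lemma hausdorff_pre_ge0 delta A : (0 <= hausdorff_pre s delta A)%E.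
Proof.
apply: le_ereal_inf_tmp => _ [C _ <-]; apply: nneseries_ge0 => k _ _.
exact: ediamX_ge0.
Qed.

Lemma hausdorff_pre_le delta A : 0 < delta ->
  (hausdorff_pre s delta A <= hausdorff s A)%E.
Proof. by move=> d0; apply: ereal_sup_ubound; exists delta. Qed.

Lemma hausdorff_ge0 A : (0 <= hausdorff s A)%E.
Proof.
exact: le_trans (hausdorff_pre_ge0 1 A) (hausdorff_pre_le A ltr01).
Qed.

Lemma hausdorff_le A (x : \bar R) :
  (forall delta, 0 < delta -> (hausdorff_pre s delta A <= x)%E) ->
  (hausdorff s A <= x)%E.
Proof. by move=> Ax; apply: ge_ereal_sup => _ [delta d0 <-]; exact: Ax. Qed.

Lemma subset_hausdorff_pre delta A B : A `<=` B ->
  (hausdorff_pre s delta A <= hausdorff_pre s delta B)%E.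
Proof.
move=> AB; apply: ereal_inf_le_tmp => _ [C [BC Cd] <-]; exists C => //; split => //.
exact: subset_trans BC.
Qed.

Lemma subset_hausdorff A B : A `<=` B -> (hausdorff s A <= hausdorff s B)%E.
Proof.
move=> AB; apply: hausdorff_le => delta d0.
exact: le_trans (subset_hausdorff_pre delta AB) (hausdorff_pre_le _ d0).
Qed.

(** Almost optimal covers of the [A i], with errors [e / 2 ^ i.+1], are merged into one sequence
    through a bijection of [nat] with pairs. An infinite summand makes the bound trivial and is set
    aside first. *)
Lemma hausdorff_pre_bigcup delta (A : (set 'rV[R]_n)^nat) :
  (hausdorff_pre s delta (\bigcup_i A i) <=
   \sum_(0 <= i <oo) hausdorff_pre s delta (A i))%E.
Proof.
have [[i ioo]|] := pselect (exists i, hausdorff_pre s delta (A i) = +oo%E).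
  rewrite (eseries_pinfty _ _ ioo) ?leey// => k _.
  by rewrite -ltNye (lt_le_trans _ (hausdorff_pre_ge0 _ _)).
rewrite -forallNE => Aoo.
apply/lee_addgt0Pr => e e0.
apply: le_trans (epsilon_trick _ _ (ltW e0)); last first.
  by move=> k; exact: hausdorff_pre_ge0.
have /choice[G PG] : forall i, exists C : (set 'rV[R]_n)^nat,
    [/\ A i `<=` \bigcup_k C k, forall k, (ediam (C k) <= delta%:E)%E &
      (\sum_(0 <= k <oo) ediam (C k) ^+ s <=
        hausdorff_pre s delta (A i) + (e / (2 ^ i.+1)%:R)%:E)%E].
  move=> i; have fi : hausdorff_pre s delta (A i) \is a fin_num.
    by rewrite ge0_fin_numE ?hausdorff_pre_ge0// ltey; exact/eqP.
  have [|_ [C [AC Cd] <-] /ltW Clt] :=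
    @lb_ereal_inf_adherent _ _ (e / (2 ^ i.+1)%:R) _ fi; first by rewrite divr_gt0.
  by exists C.
have /card_esym/ppcard_eqP[f] := card_nat2.
pose C k := G (f k).1 (f k).2.
apply: (@le_trans _ _ (\sum_(0 <= k <oo) ediam (C k) ^+ s)%E).
  apply: ereal_inf_lbound; exists C => //; split => [x [i _ Aix]|k].
    have [j _ Gijx] := (let: And3 h _ _ := PG i in h) x Aix.
    by exists (f^-1%FUN (i, j)) => //; rewrite /C invK ?inE.
  by have [_ + _] := PG (f k).1; exact.
have a0 k : (0 <= ediam (G k.1 k.2) ^+ s)%E by exact: ediamX_ge0.
rewrite [leLHS]nneseries_esumT; last by move=> k; exact: ediamX_ge0.
rewrite -(@reindex_esum _ _ _ setT setT f (fun k => ediam (G k.1 k.2) ^+ s)%E);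
  last exact: bij.
rewrite nneseries_esumT; last first.
  by move=> k; rewrite adde_ge0 ?hausdorff_pre_ge0// lee_fin divr_ge0// ltW.
rewrite (_ : [set: nat * nat] = setT `*`` (fun=> setT)); last exact/seteqP.
rewrite -(@esum_esum _ _ _ _ _ (fun i j => ediam (G i j) ^+ s)%E); last first.
  by move=> i j _ _; exact: ediamX_ge0.
apply: le_esum => i _; rewrite -nneseries_esumT; last by move=> k; exact: ediamX_ge0.
by have [] := PG i.
Qed.

Lemma hausdorff_bigcup (A : (set 'rV[R]_n)^nat) :
  (hausdorff s (\bigcup_i A i) <= \sum_(0 <= i <oo) hausdorff s (A i))%E.
Proof.
apply: hausdorff_le => delta d0; apply: le_trans (hausdorff_pre_bigcup _ _) _.
by apply: lee_nneseries => i *; [exact: hausdorff_pre_ge0|exact: hausdorff_pre_le].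
Qed.

Lemma hausdorff_bigcup0 (A : (set 'rV[R]_n)^nat) :
  (forall i, hausdorff s (A i) = 0%E) -> hausdorff s (\bigcup_i A i) = 0%E.
Proof.
move=> A0; apply/eqP; rewrite eq_le hausdorff_ge0 andbT.
by rewrite (le_trans (hausdorff_bigcup _))// eseries0// => i *; exact: A0.
Qed.

Lemma subset_hausdorff0 A B : A `<=` B -> hausdorff s B = 0%E -> hausdorff s A = 0%E.
Proof.
move=> AB B0; apply/eqP; rewrite eq_le hausdorff_ge0 andbT -B0.
exact: subset_hausdorff.
Qed.

Hypothesis s_gt0 : (0 < s)%N.

(** Here [0 < s] matters: the power [0 ^+ 0] is 1, so for [s = 0] a sequence of empty sets would
    have an infinite sum. *)
Lemma hausdorff0 : hausdorff s (set0 : set 'rV[R]_n) = 0%E.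
Proof.
apply/eqP; rewrite eq_le hausdorff_ge0 andbT; apply: hausdorff_le => delta d0.
apply: ereal_inf_lbound; exists (fun=> set0).
  by split=> [//|k]; rewrite ediam_set0 lee_fin ltW.
by rewrite eseries0// => i *; rewrite ediam_set0 -(prednK s_gt0) expeS mul0e.
Qed.

Lemma hausdorffU A B : (hausdorff s (A `|` B) <= hausdorff s A + hausdorff s B)%E.
Proof.
rewrite -bigcup2E (le_trans (hausdorff_bigcup _))//.
rewrite (@nneseries_split _ _ 0 2) => [|k *]; last exact: hausdorff_ge0.
rewrite big_mkord big_ord_recr big_ord1/= eseries0 ?adde0// => -[|[|i]]// *.
by rewrite /bigcup2/= hausdorff0.
Qed.

End Hausdorff.

(** * Hausdorff measure of balls *)

Section CubeContent.
Context {R : realType}.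

(** The indices counted lie in a window that starts at the least of them and has length at most
    [2 r / b]. *)
Lemma card_grid_le (M : nat) (a b x r : R) : 0 < b -> 0 <= r ->
  #|[pred i : 'I_M | `|a + b * i%:R - x| < r]|%:R <= r *+ 2 / b + 1.
Proof.
move=> b0 r0; set A := [pred i | _]; have L0 : 0 <= r *+ 2 / b.
  by rewrite divr_ge0// ?mulrn_wge0// ltW.
have [->|/card_gt0P[j Aj]] := posnP #|A|; first by rewrite addr_ge0.
have [i0 Ai0 min_i0] := arg_minnP (@nat_of_ord M) Aj.
suff : (#|A| <= (Num.trunc (r *+ 2 / b)).+1)%N.
  rewrite -(ler_nat R) => /le_trans; apply.
  by rewrite -natr1 lerD2r truncn_le.
rewrite cardE -(size_map (@nat_of_ord M)) -[leqRHS](size_iota i0).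
apply: uniq_leq_size; first by rewrite map_inj_uniq ?enum_uniq//; exact: val_inj.
move=> k /mapP[i + ->{k}]; rewrite mem_enum => Ai.
have i0i : (i0 <= i)%N by exact: min_i0.
rewrite mem_iota i0i/= -ltn_subLR// ltnS truncn_ge_nat// natrB//.
rewrite ler_pdivlMr//.
move: (Ai) (Ai0 : A i0); rewrite !inE !ltr_norml => /andP[_ ir] /andP[i0r _].
by rewrite mulrBl mulr2n; nra.
Qed.

Lemma ler_prodX (m : nat) (F : 'I_m -> R) (y : R) :
  (forall j, 0 <= F j <= y) -> \prod_j F j <= y ^+ m.
Proof.
move=> Fy; rewrite -[leRHS](_ : \prod_(j < m) y = _); last first.
  by rewrite prodr_const card_ord.
by apply: ler_prod => j _; exact: Fy.
Qed.

(* Count the points of a grid finer than all the radii. *)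
Lemma finite_ball_cover_sum (m : nat) (I : eqType) (s : seq I) (c : I -> 'rV[R]_m)
    (r : I -> R) (a : 'rV[R]_m) (rho : R) :
  0 < rho -> (forall k, 0 < r k) ->
  (forall x : 'rV[R]_m,
    (forall j, a ord0 j <= x ord0 j <= a ord0 j + rho) ->
    exists2 k, k \in s & ball (c k) (r k) x) ->
  rho ^+ m <= \sum_(k <- s) (3 * r k) ^+ m.
Proof.
move=> rho0 r0 cov.
(* The mesh [h = rho / M] is at most every radius [r k], so that the count [2 r / h + 1] in each
   direction is at most [3 r / h]. *)
pose M := (\max_(k <- s) (Num.trunc (rho / r k)).+1).+1.
have M0 : 0 < M%:R :> R by rewrite ltr0n.
pose h := rho / M%:R.
have h0 : 0 < h by rewrite divr_gt0.
have hr k : k \in s -> h <= r k.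
  move=> ks; rewrite /h ler_pdivrMr// mulrC -ler_pdivrMr//.
  apply/ltW/(lt_le_trans (truncnS_gt _)); rewrite ler_nat leqW//.
  exact: (@leq_bigmax_seq _ _ xpredT (fun k => (Num.trunc (rho / r k)).+1)).
pose pt (f : {ffun 'I_m -> 'I_M}) : 'rV[R]_m := \row_j (a ord0 j + h * (f j)%:R).
pose P k := [pred f | `[< ball (c k) (r k) (pt f) >]].
have ptP f : exists2 k, k \in s & f \in P k.
  have [j|k ks kf] := cov (pt f); last by exists k => //; exact/asboolP.
  rewrite mxE lerDl mulr_ge0// ?(ltW h0)//= lerD2l /h mulrAC ler_pdivrMr//.
  by rewrite ler_wpM2l// ?(ltW rho0)// ler_nat ltnW.
have cardP k : k \in s -> (#|P k|)%:R <= (3 * r k / h) ^+ m.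
  move=> ks; pose F j := [pred i : 'I_M | `|a ord0 j + h * i%:R - c k ord0 j| < r k].
  apply: (@le_trans _ _ (\prod_j #|F j|%:R)).
    rewrite -natr_prod ler_nat.
    have -> : (\prod_j #|F j| = #|family F|)%N.
      by rewrite card_family foldrE big_map big_enum.
    apply/subset_leq_card/fintype.subsetP => f /asboolP kf; apply/familyP => j.
    rewrite inE distrC; move: kf; rewrite -ball_normE /= => /(le_lt_trans _).
    by have := norm_coord_le (c k - pt f) j; rewrite !mxE => + /(_ _) h'; apply: h'.
  apply: ler_prodX => j; rewrite ler0n/=.
  apply: le_trans (card_grid_le _ _ _ h0 (ltW (r0 k))) _.
  rewrite -lerBrDl -mulrBl (_ : 3 * r k - r k *+ 2 = r k); last by ring.
  by rewrite ler_pdivlMr// mul1r hr.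
have : (M ^ m)%:R <= \sum_(k <- s) (3 * r k / h) ^+ m.
  apply: (@le_trans _ _ (\sum_(k <- s) #|P k|%:R)); last first.
    by rewrite !big_seq; apply: ler_sum => k; exact: cardP.
  rewrite -natr_sum ler_nat -{1}(card_ord M) -{1}(card_ord m) -card_ffun.
  under eq_bigr do rewrite -sum1_card big_mkcond.
  rewrite exchange_big -sum1_card; apply: leq_sum => f _.
  have [k ks Pkf] := ptP f.
  by rewrite (big_rem k ks)/= Pkf leq_addr.
under eq_bigr do rewrite expr_div_n.
rewrite -mulr_suml ler_pdivlMr ?exprn_gt0// natrX -exprMn.
by rewrite /h mulrCA mulfV ?gt_eqF// mulr1.
Qed.

End CubeContent.

Section LipschitzImage.
Context {R : realType}.

Lemma expeZl (r : R) (x : \bar R) s : ((r%:E * x) ^+ s = (r ^+ s)%:E * x ^+ s)%E.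
Proof.
by elim: s => [|s IH]; rewrite ?expe0 ?mule1// !expeS exprS EFinM IH muleACA.
Qed.

(** The pieces of a cover are intersected with [S] before [f] is applied, since [f] is Lipschitz
    only there. Covers of mesh [delta / L] have images of mesh [delta]. *)
Lemma hausdorff_image_le (n d s : nat) (f : 'rV[R]_n -> 'rV[R]_d) (L : R)
    (S : set 'rV[R]_n) : 0 < L ->
  (forall x y, S x -> S y -> enorm (f x - f y) <= L * enorm (x - y)) ->
  (hausdorff s (f @` S) <= (L ^+ s)%:E * hausdorff s S)%E.
Proof.
move=> L0 fL; apply: hausdorff_le => delta d0.
have dL0 : 0 < delta / L by rewrite divr_gt0.
have Ls0 : 0 < L ^+ s by rewrite exprn_gt0.
apply: le_trans (lee_wpmul2l _ (hausdorff_pre_le _ _ dL0)); last first.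
  by rewrite lee_fin ltW.
rewrite -lee_pdivrMl//; apply: le_ereal_inf_tmp => _ [C [SC Cd] <-].
rewrite lee_pdivrMl// -nneseriesZl; last by move=> k *; exact: ediamX_ge0.
have fC k : (ediam (f @` (C k `&` S)) <= L%:E * ediam (C k))%E.
  apply: ge_ereal_sup => _ [->|[_ [x [Cx Sx] <-] [_ [y [Cy Sy] <-] <-]]].
    by rewrite mule_ge0 ?ediam_ge0// lee_fin ltW.
  apply: (@le_trans _ _ (L * enorm (x - y))%:E); first by rewrite lee_fin fL.
  by rewrite EFinM lee_wpmul2l ?lee_fin ?(ltW L0)// le_ediam.
apply: (@le_trans _ _ (\sum_(0 <= k <oo) ediam (f @` (C k `&` S)) ^+ s)%E).
  apply: ereal_inf_lbound; exists (fun k => f @` (C k `&` S)) => //; split.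
    by move=> _ [x Sx <-]; have [k _ Ckx] := SC x Sx; exists k => //; exists x.
  move=> k; apply: le_trans (fC k) _.
  by rewrite -lee_pdivlMl// -EFinM mulrC.
apply: lee_nneseries => k _ *; first exact: ediamX_ge0.
by rewrite -expeZl lee_expe// ediam_ge0.
Qed.

End LipschitzImage.

Section Ball.
Context {R : realType}.

(** The pieces of a cover are enlarged to open balls of radius [d k + eta k]; finitely many of them
    cover a cube of side [rho], and the grid count applies. As $(d+\eta)^m\le2^m(d^m+\eta^m)$, the
    sum of the $d^m$ is at least $(\rho/6)^m-(\rho/12)^m$, which is at least $(\rho/12)^m$ for
    positive [m]. *)
Lemma hausdorff_pre_ball_ge (m : nat) (p : 'rV[R]_m) (rho delta : R) :
  (0 < m)%N -> 0 < rho ->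
  (((rho / 12) ^+ m)%:E <= hausdorff_pre m delta (ball p rho))%E.
Proof.
move=> m0 rho0; apply: le_ereal_inf_tmp => _ [C [pC Cd] <-].
pose d k : R := fine (ediam (C k)).
have dE k : ediam (C k) = (d k)%:E.
  rewrite fineK// ge0_fin_numE ?ediam_ge0//.
  by rewrite (le_lt_trans (Cd k))// ltry.
have d_ge0 k : 0 <= d k by rewrite -lee_fin -dE ediam_ge0.
pose eta k : R := rho / 12 / (2 ^ k.+1)%:R.
have eta0 k : 0 < eta k by rewrite !divr_gt0 ?ltr0n ?expn_gt0.
pose c k : 'rV[R]_m := xget p (C k).
pose r k := d k + eta k.
have r0 k : 0 < r k by rewrite ltr_wpDl.
have Cball k : C k `<=` ball (c k) (r k).
  move=> x Cx; rewrite -ball_normE /=.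
  apply: (@le_lt_trans _ _ (d k)); last by rewrite ltrDl.
  rewrite (le_trans (norm_le_enorm _))// -lee_fin -dE; apply: le_ediam => //.
  by apply: xgetPex; exists x.
pose K : set 'rV[R]_m :=
  [set x | forall j, (`[p ord0 j - rho / 2, p ord0 j + rho / 2]%classic : set R) (x ord0 j)].
have cK : compact K.
  apply: (@rV_compact R m
    (fun j => `[p ord0 j - rho / 2, p ord0 j + rho / 2]%classic)) => j.
  exact: segment_compact.
have KC : K `<=` cover setT (fun k => ball (c k) (r k)).
  move=> x Kx; have [|k _ Ckx] := pC x; last by exists k => //; exact: Cball.
  rewrite -ball_normE /=; apply: (@le_lt_trans _ _ (rho / 2)); last by lra.
  apply: norm_le_coord => [|j]; first by rewrite divr_ge0// ltW.
  move: (Kx j); rewrite /= in_itv/= !mxE ler_norml => /andP[]; lra.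
move: cK; rewrite compact_cover => /(_ _ _ _ _ KC)[k _|D _ KD]; first exact: ball_open.
pose N := (\max_(k <- finmap.enum_fset D) k).+1.
have main : rho ^+ m <= \sum_(k <- index_iota 0 N) (3 * r k) ^+ m.
  apply: (@finite_ball_cover_sum _ _ _ _ c r (p - const_mx (rho / 2))) => // x Kx.
  have [j|k /= kD kx] := KD x.
    by move: (Kx j); rewrite /= in_itv/= !mxE => /andP[? ?]; lra.
  exists k => //; rewrite mem_index_iota/= ltnS.
  exact: (@leq_bigmax_seq _ _ xpredT id).
have e0 : 0 <= (rho / 12) ^+ m by rewrite exprn_ge0// divr_ge0// ltW.
have : (((rho / 6) ^+ m)%:E <=
    \sum_(0 <= k <oo) ediam (C k) ^+ m + ((rho / 12) ^+ m)%:E)%E.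
  apply: le_trans (epsilon_trick _ _ e0); last by move=> k; exact: ediamX_ge0.
  apply: le_trans (nneseries_lim_ge N _); last first.
    by move=> k *; rewrite adde_ge0 ?ediamX_ge0// lee_fin divr_ge0.
  under eq_bigr do rewrite dE -EFin_expe -EFinD.
  rewrite sumEFin lee_fin expr_div_n ler_pdivrMr ?exprn_gt0//.
  apply: le_trans main _; rewrite mulr_suml; apply: ler_sum => k _.
  rewrite (_ : 6 = 3 * 2 :> R); last by ring.
  rewrite !exprMn mulrCA ler_wpM2l ?exprn_ge0//.
  have [de|ed] := leP (d k) (eta k).
  - apply: (@le_trans _ _ (eta k ^+ m * 2 ^+ m)).
      rewrite -exprMn lerXn2r ?nnegrE ?(ltW (r0 k)) ?(mulr_ge0 (ltW (eta0 k)))//.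
      by rewrite /r; lra.
    rewrite ler_wpM2r ?exprn_ge0// ler_wpDl ?exprn_ge0//.
    rewrite /eta expr_div_n -exprMn ler_wpM2l// lef_pV2 ?posrE ?exprn_gt0 ?ltr0n ?expn_gt0//.
    by rewrite -natrX ler_nat -expnM leq_exp2l// leq_pmulr.
  - apply: (@le_trans _ _ (d k ^+ m * 2 ^+ m)).
      rewrite -exprMn lerXn2r ?nnegrE ?(ltW (r0 _)) ?(mulr_ge0 (d_ge0 k))//.
      by rewrite /r; lra.
    by rewrite ler_wpM2r ?exprn_ge0// lerDl -exprMn divr_ge0.
rewrite -leeBlDr//; apply: le_trans; rewrite -EFinB lee_fin.
have -> : (rho / 6) ^+ m = 2 ^+ m * (rho / 12) ^+ m.
  by rewrite -exprMn; congr (_ ^+ _); field.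
rewrite -[X in _ - X]mul1r -mulrBl ler_peMl// lerBrDr -(prednK m0) exprS.
by rewrite -[leLHS]mulr1 ler_wpM2l// exprn_ege1// ler1n.
Qed.

Lemma hausdorff_ball_ge (m : nat) (p : 'rV[R]_m) (rho : R) :
  (0 < m)%N -> 0 < rho -> (((rho / 12) ^+ m)%:E <= hausdorff m (ball p rho))%E.
Proof.
move=> m0 rho0; apply: le_trans (hausdorff_pre_le _ _ ltr01).
exact: hausdorff_pre_ball_ge.
Qed.

End Ball.

(** * Covering and density *)

Section Vitali.
Context {R : realType} {d : nat}.
Local Notation T := 'rV[R]_d.

Lemma rational_dense (x : T) (r : R) : 0 < r ->
  exists q : 'rV[rat]_d, `|x - map_mx ratr q| < r.
Proof.
move=> r0; have /choice[q qP] j : exists q : rat, `|x ord0 j - ratr q| < r.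
  have [|q] := @rat_in_itvoo R (x ord0 j - r) (x ord0 j + r).
    by rewrite ltrBlDr -addrA ltrDl addr_gt0.
  rewrite in_itv/= => /andP[q1 q2]; exists q.
  by rewrite ltr_distlC q1 q2.
exists (\row_j q j); apply: norm_lt_coord => // j.
by rewrite !mxE; exact: qP.
Qed.

Let B (b : T * R) : set T := ball b.1 b.2.

Lemma vitali_covering (F : set (T * R)) (delta : R) :
  (forall b, F b -> 0 < b.2 <= delta) ->
  exists D, [/\ D `<=` F, trivIset D B &
    forall b, F b -> exists2 b', D b' & B b `<=` ball b'.1 (5 * b'.2)].
Proof.
move=> Fd.
(* The last clause propagates along chains, and forces a maximal [D] to meet every
   ball of [F], since a ball of nearly maximal radius could be added otherwise. *)
pose P (D : set (T * R)) := [/\ D `<=` F, trivIset D B &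
  forall b, F b -> (exists2 b', D b' & B b `&` B b' !=set0) ->
    exists2 b', D b' & B b `&` B b' !=set0 /\ b.2 <= 2 * b'.2].
have [|D [[DF tD Dlarge] Dmax]] := @Zorn_bigcup _ P.
  move=> Q QP Qtot; split.
  - by move=> b [D QD Db]; have [+ _ _] := QP D QD; exact.
  - move=> b b' [D QD Db] [D' QD' Db'] bb'.
    have [DD'|D'D] := Qtot D D' QD QD'.
    + by have [_ + _] := QP D' QD'; apply => //; exact: DD'.
    + by have [_ + _] := QP D QD; apply => //; exact: D'D.
  - move=> b Fb [b' [D QD Db'] bb'].
    have [_ _ /(_ b Fb)[|b'' Db'' h]] := QP D QD; first by exists b'.
    by exists b'' => //; exists D.
suff meet b : F b -> exists2 b', D b' & B b `&` B b' !=set0.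
  exists D; split => // b Fb.
  have [b' Db' [[z [/= bz b'z]] bb']] := Dlarge b Fb (meet b Fb).
  (* The balls meet and [b.2 <= 2 * b'.2], so points of [B b] are within
     [b'.2 + 2 * b.2 <= 5 * b'.2] of [b'.1]. *)
  exists b' => // y /= yb; move: bz b'z yb; rewrite /B -!ball_normE /= => bz b'z yb.
  have -> : b'.1 - y = (b'.1 - z) - (b.1 - z) + (b.1 - y).
    by rewrite opprB !subrKA.
  rewrite (le_lt_trans (ler_normD _ _))//.
  have := ler_normB (b'.1 - z) (b.1 - z); lra.
move=> Fb; apply: contrapT => /forall2NP nomeet.
pose F' := [set b | F b /\ forall b', D b' -> B b `&` B b' = set0].
have F'b : F' b.
  split => // b' Db'; have [//|] := nomeet b'.
  by move/set0P/negP/negPn/eqP.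
pose S := [set b.2 | b in F'].
have supS : has_sup S.
  split; first by exists b.2, b.
  by exists delta => _ [b' [/Fd/andP[_ ?] _] <-].
have S0 : 0 < sup S.
  have /andP[b0 _] := Fd b Fb; apply: lt_le_trans b0 _.
  by apply: ub_le_sup; [case: supS|exists b].
have [|_ [b0 F'b0 <-] b0S] := @sup_adherent _ S (sup S / 2) _ supS.
  by rewrite divr_gt0.
have B0 c : F c -> B c !=set0.
  by move=> /Fd/andP[? _]; exists c.1; exact: ballxx.
apply: (Dmax (D `|` [set b0])); last first.
  split.
  - by move=> c [/DF//|->]; case: F'b0.
  - move=> c c' [Dc|->] [Dc'|->]//; first exact: tD.
    + by rewrite setIC (F'b0.2 _ Dc) => -[].
    + by rewrite (F'b0.2 _ Dc') => -[].
  - move=> c Fc cD.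
    have [[c' Dc' cc']|] := pselect (exists2 c', D c' & B c `&` B c' !=set0).
      have [|c'' Dc'' ?] := Dlarge c Fc; first by exists c'.
      by exists c'' => //; left.
    move=> /forall2NP cnD; have F'c : F' c.
      split => // c' Dc'; have [//|] := cnD c'.
      by move/set0P/negP/negPn/eqP.
    case: cD => c' [Dc'|->] cc'.
      by have [_ /(_ _ Dc') cc0] := F'c; move: cc'; rewrite cc0 => -[].
    exists b0; [by right|split => //].
    have : c.2 <= sup S by apply: ub_le_sup; [case: supS|exists c].
    by move: b0S; lra.
split; first by left.
move=> /(_ b0 (or_intror erefl)) Db0.
have [z zb0] := B0 b0 F'b0.1.
by have := F'b0.2 b0 Db0; rewrite setIid => /seteqP[/(_ z zb0)].
Qed.

(* Countability comes from rational points in the balls; the unused indices carry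
   the empty ball of radius 0. *)
Lemma vitali_sequence (F : set (T * R)) (delta : R) :
  (forall b, F b -> 0 < b.2 <= delta) ->
  exists c : nat -> T * R,
    [/\ forall k, F (c k) \/ (c k).2 = 0, trivIset setT (fun k => B (c k)) &
      forall b, F b -> exists k, B b `<=` ball (c k).1 (5 * (c k).2)].
Proof.
move=> Fd; have [D [DF tD DB]] := vitali_covering Fd.
have /choice[q qP] b : exists q : 'rV[rat]_d, D b -> B b (map_mx ratr q).
  have [/DF/Fd/andP[b0 _]|nDb] := pselect (D b); last by exists 0.
  by have [q ?] := rational_dense b.1 b0; exists q; rewrite /B -ball_normE.
pose code b := pickle (q b).
have code_inj b b' : D b -> D b' -> code b = code b' -> b = b'.
  move=> Db Db' /(pcan_inj pickleK) qq; apply: tD => //.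
  by exists (map_mx ratr (q b)); split; [exact: qP|rewrite qq; exact: qP].
pose c k := xget (0, 0) [set b | D b /\ code b = k].
have cP k : (D (c k) /\ code (c k) = k) \/ c k = (0, 0).
  by rewrite /c; case: xgetP; [left|right].
have cD b : D b -> c (code b) = b.
  move=> Db; have [[Dc cc]|c0] := cP (code b); first exact: code_inj.
  by move: c0; rewrite /c; case: xgetP => [b' -> [Db' /code_inj->]//|/(_ b)[]].
exists c; split => [k|k k' _ _|b /DB[b' Db' bb']].
- by have [[/DF ? _]|->] := cP k; [left|right].
- move=> kk'; have [[Dk <-]|ck0] := cP k; last first.
    by case: kk' => z []; rewrite /B ck0 -ball_normE /= normr_lt0.
  have [[Dk' <-]|ck0] := cP k'; last first.
    by case: kk' => z [_]; rewrite /B ck0 -ball_normE /= normr_lt0.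
  by congr code; exact: tD.
- by exists (code b'); rewrite cD.
Qed.

End Vitali.

Section Density.
Context {R : realType} {n d : nat}.
Variable sigma : {measure set 'rV[R]_n -> \bar R}.

Lemma open_measurable_rV (U : set 'rV[R]_n) : open U -> measurable U.
Proof. exact: sub_sigma_algebra. Qed.

(** Vitali's lemma for the balls of large mass inside [V]: the disjoint ones are controlled by
    [sigma], and their fivefold enlargements cover [A]. In the applications [f] is the identity or
    an oblique projection, which gives densities of projected measures. *)
Lemma hausdorff_density_le (f : 'rV[R]_n -> 'rV[R]_d) (K : set 'rV[R]_n)
    (A V : set 'rV[R]_d) (s : nat) (t : R) :
  continuous f -> measurable K -> open V -> A `<=` V -> (0 < s)%N -> 0 < t ->
  (forall x delta, A x -> 0 < delta -> exists2 r, 0 < r < delta &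
     ((t * r ^+ s)%:E <= sigma (f @^-1` ball x r `&` K))%E) ->
  (hausdorff s A <=
     ((10 * d%:R) ^+ s / t)%:E * sigma (f @^-1` V `&` K))%E.
Proof.
move=> cf mK oV AV s0 t0 dens; apply: hausdorff_le => delta delta0.
have mf U : open U -> measurable (f @^-1` U `&` K).
  by move=> oU; apply: measurableI => //; apply: open_measurable_rV; exact: open_comp.
(* A sup-norm ball of radius [5 r] has Euclidean diameter at most [10 d r]; adding 1 keeps the
   denominator positive for [d = 0]. *)
have d0 : 0 < (10 * d%:R + 1) :> R by rewrite ltr_wpDl// mulr_ge0.
pose F := [set b : 'rV[R]_d * R | [/\ A b.1, 0 < b.2 <= delta / (10 * d%:R + 1),
   ball b.1 b.2 `<=` V & ((t * b.2 ^+ s)%:E <= sigma (f @^-1` ball b.1 b.2 `&` K))%E]].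
have [|c [cF trivc Fc]] := @vitali_sequence R d F (delta / (10 * d%:R + 1)).
  by move=> b [].
have c0 k : 0 <= (c k).2 by have [[_ /andP[/ltW]]|->] := cF k.
have diamc k : (ediam (ball (c k).1 (5 * (c k).2)) <= (10 * d%:R * (c k).2)%:E)%E.
  apply: le_trans (ediam_ball_le _ _) _; first by rewrite mulr_ge0.
  by rewrite lee_fin mulr2n; lra.
apply: (@le_trans _ _ (\sum_(0 <= k <oo) ediam (ball (c k).1 (5 * (c k).2)) ^+ s)%E).
  apply: ereal_inf_lbound; exists (fun k => ball (c k).1 (5 * (c k).2)) => //; split.
    move=> x Ax; have [e /= e0 eV] := (nbhs_ballP _ _).1 (open_nbhs_nbhs (conj oV (AV x Ax))).
    have [|r /andP[r0]] := dens x (Num.min e (delta / (10 * d%:R + 1))) Ax.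
      by rewrite lt_min e0 divr_gt0.
    rewrite lt_min => /andP[re rd] tr.
    have [|k kP] := Fc (x, r).
      split => //=; first by rewrite r0 ltW.
      by apply: subset_trans eV; apply: le_ball; exact: ltW.
    by exists k => //; apply: kP; exact: ballxx.
  move=> k; apply: le_trans (diamc k) _; rewrite lee_fin.
  have : (c k).2 <= delta / (10 * d%:R + 1).
    by have [[_ /andP[]]|->] := cF k; rewrite // divr_ge0// ltW.
  by rewrite ler_pdivlMr// mulrDr mulr1 mulrC; have := c0 k; lra.
apply: (@le_trans _ _ (((10 * d%:R) ^+ s / t)%:E *
    \sum_(0 <= k <oo) sigma (f @^-1` ball (c k).1 (c k).2 `&` K))%E).
  rewrite -nneseriesZl; last by move=> k *; exact: measure_ge0.
  apply: lee_nneseries => k *; first exact: ediamX_ge0.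
  apply: le_trans (lee_expe _ (ediam_ge0 _) (diamc k)) _.
  have tc : ((t * (c k).2 ^+ s)%:E <= sigma (f @^-1` ball (c k).1 (c k).2 `&` K))%E.
    have [[]//|->] := cF k.
    by rewrite expr0n gtn_eqF// mulr0 measure_ge0.
  rewrite -EFin_expe exprMn; apply: le_trans (lee_wpmul2l _ tc).
    by rewrite -EFinM mulrA divfK// gt_eqF.
  by rewrite lee_fin divr_ge0 ?exprn_ge0 ?mulr_ge0// ltW.
rewrite lee_wpmul2l ?lee_fin//.
  by rewrite divr_ge0 ?exprn_ge0 ?mulr_ge0// ltW.
pose G k := f @^-1` ball (c k).1 (c k).2 `&` K.
have mG k : measurable (G k) by apply: mf; exact: ball_open.
apply: (@le_trans _ _ (sigma (\bigcup_k G k))).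
  rewrite measure_bigcup//=.
    by under [leRHS]eq_eseriesl do rewrite in_setT.
  by move=> i j _ _ [z [[fi _] [fj _]]]; apply: trivc => //; exists (f z).
apply: le_measure; rewrite ?inE; [exact: bigcup_measurable|exact: mf|].
move=> z [k _ [/= fz Kz]]; split => //; have [[_ _ + _]|ck0] := cF k; first exact.
by move: fz; rewrite ck0 -ball_normE /= normr_lt0.
Qed.

End Density.

Section NullSets.
Context {R : realType} {n : nat}.
Local Notation T := 'rV[R]_n.
Variables (sigma : {measure set T -> \bar R}) (s : nat).
Hypothesis s_gt0 : (0 < s)%N.

Lemma hausdorff_eq0_of_le (d : nat) (A : set 'rV[R]_d) (C : R) : 0 <= C ->
  (forall eps : R, 0 < eps -> (hausdorff s A <= (C * eps)%:E)%E) ->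
  hausdorff s A = 0%E.
Proof.
move=> C0 Ale; apply/eqP; rewrite eq_le hausdorff_ge0 andbT.
apply/lee_addgt0Pr => e e0; rewrite add0e.
have C1 : 0 < C + 1 by rewrite ltr_wpDl.
have /Ale/le_trans : 0 < e / (C + 1) by rewrite divr_gt0.
by apply; rewrite lee_fin mulrA ler_pdivrMr// mulrC ler_pM2l// lerDl.
Qed.

(** [hausdorff_density_le] holds on this set with every threshold [t], and its bound is proportional
    to [1 / t]. *)
Lemma hausdorff_infinite_density (d : nat) (f : T -> 'rV[R]_d) (K : set T) :
  continuous f -> measurable K -> (sigma K < +oo)%E ->
  hausdorff s [set p | forall (t delta : R), 0 < t -> 0 < delta ->
    exists2 r : R, 0 < r < delta &
      ((t * r ^+ s)%:E <= sigma (f @^-1` ball p r `&` K))%E] = 0%E.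
Proof.
move=> cf mK Koo; set A := [set p | _].
have Kfin : sigma K \is a fin_num by rewrite ge0_fin_numE// measure_ge0.
apply: (@hausdorff_eq0_of_le _ _ ((10 * d%:R) ^+ s * fine (sigma K))).
  by rewrite mulr_ge0 ?exprn_ge0 ?mulr_ge0// fine_ge0// measure_ge0.
move=> e e0; have ie0 : 0 < e^-1 by rewrite invr_gt0.
have : (hausdorff s A <=
    ((10 * d%:R) ^+ s / e^-1)%:E * sigma (f @^-1` setT `&` K))%E.
  apply: hausdorff_density_le => //; first exact: openT.
  by move=> x delta Ax delta0; exact: Ax.
by rewrite preimage_setT setTI -(fineK Kfin) -EFinM invrK mulrAC.
Qed.

Hypothesis outer : forall (A : set T) (eps : R), measurable A -> bounded_set A ->
  0 < eps -> exists W : set T, [/\ open W, A `<=` W & (sigma (W `\` A) <= eps%:E)%E].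

(** The set is cut into countably many bounded parts with a fixed density threshold. Each part has
    open neighbourhoods with arbitrarily little mass off [A], and only this mass enters
    [hausdorff_density_le]. *)
Lemma hausdorff_outer_density (A : set T) : measurable A ->
  hausdorff s [set x | A x /\ exists2 t : R, 0 < t & forall delta : R, 0 < delta ->
    exists2 r : R, 0 < r < delta & ((t * r ^+ s)%:E <= sigma (ball x r `\` A))%E] = 0%E.
Proof.
move=> mA; set Z := [set x | _].
pose Zk (k : nat) := [set x | [/\ A x, ball 0 k%:R x & forall delta : R, 0 < delta ->
  exists2 r : R, 0 < r < delta &
    ((k.+1%:R^-1 * r ^+ s)%:E <= sigma (ball x r `\` A))%E]].
apply: (@subset_hausdorff0 _ _ _ _ (\bigcup_k Zk k)).
  move=> x [Ax [t t0 xt]].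
  pose k := maxn (Num.trunc `|x|).+1 (Num.trunc t^-1).
  exists k => //; split => //.
    rewrite -ball_normE /= sub0r normrN (lt_le_trans (truncnS_gt _))// ler_nat.
    exact: leq_maxl.
  move=> delta /xt[r rd tr]; exists r => //; apply: le_trans tr.
  rewrite lee_fin ler_wpM2r ?exprn_ge0//; first by case/andP: rd => /ltW.
  rewrite -[leRHS]invrK lef_pV2 ?posrE ?invr_gt0//.
  by rewrite (le_trans (ltW (truncnS_gt _)))// ler_nat ltnS leq_maxr.
apply: hausdorff_bigcup0 => k.
apply: (@hausdorff_eq0_of_le _ _ ((10 * n%:R) ^+ s / k.+1%:R^-1)).
  by rewrite divr_ge0 ?exprn_ge0 ?mulr_ge0.
move=> e e0; pose B : set T := A `&` ball 0 k%:R.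
have mball : measurable (ball (0 : T) k%:R) by apply: open_measurable_rV; exact: ball_open.
have mB : measurable B by exact: measurableI.
have bB : bounded_set B.
  exists k%:R; split => // M kM x [_]; rewrite -ball_normE /= sub0r normrN.
  by move=> /ltW/le_trans; apply; exact: ltW.
have [W [oW BW We]] := outer mB bB e0.
pose V : set T := W `&` ball 0 k%:R.
have oV : open V by apply: openI => //; exact: ball_open.
rewrite EFinM; apply: le_trans (lee_wpmul2l _ We).
  2: by rewrite lee_fin divr_ge0 ?exprn_ge0 ?mulr_ge0.
have VA : (sigma (id @^-1` V `&` ~` A) <= sigma (W `\` B))%E.
  apply: le_measure; rewrite ?inE.
  - by apply: measurableI; [exact: open_measurable_rV|exact: measurableC].
  - by apply: measurableD => //; exact: open_measurable_rV.
  - by move=> x [[Wx bx] nAx]; split => // -[].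
apply: le_trans (lee_wpmul2l _ VA).
  2: by rewrite lee_fin divr_ge0 ?exprn_ge0 ?mulr_ge0.
apply: hausdorff_density_le => //.
- by move=> x; exact: cvg_id.
- exact: measurableC.
- by move=> x [Ax bx _]; split => //; exact: BW.
- by move=> x delta [_ _ +] delta0; apply.
Qed.

End NullSets.

(** * Where a segment leaves an open set for the last time *)

Section Crossing.
Context {R : realType} {n : nat}.
Local Notation T := 'rV[R]_n.

(** [u] is the supremum of the parameters in [U]: as [U] is open, the point at [u] is not in [U],
    but it is a limit of points of [U]. *)
Lemma last_exit (U : set T) (x v : T) (t : R) : open U -> 0 <= t ->
  U x -> ~ U (x + t *: v) ->
  exists2 u, 0 < u <= t & (closure U `\` U) (x + u *: v) /\
    forall w, u < w <= t -> ~ U (x + w *: v).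
Proof.
move=> oU t0 Ux nUt.
have cl : continuous (fun w : R => x + w *: v).
  move=> w; apply: cvgD; first exact: cvg_cst.
  by apply: cvgZr_tmp; exact: cvg_id.
pose S := [set w : R | 0 <= w <= t /\ U (x + w *: v)].
have S0 : S 0 by split; rewrite ?lexx// scale0r addr0.
have supS : has_sup S by split; [exists 0|exists t => w [/andP[]]].
pose u := sup S.
have u0 : 0 <= u by apply: ub_le_sup => //; case: supS.
have ut : u <= t by apply: ge_sup => [|w [/andP[]]//]; case: supS.
have above w : u < w <= t -> ~ U (x + w *: v).
  move=> /andP[uw wt] Uw; suff : w <= u by rewrite leNgt uw.
  by apply: ub_le_sup; [case: supS|split => //; rewrite wt (le_trans u0)// ltW].
have nUu : ~ U (x + u *: v).
  move=> Uu; have {}ut : u < t.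
    by rewrite lt_neqAle ut andbT; apply/eqP => ut'; apply: nUt; rewrite -ut'.
  have /nbhs_ballP[e /= e0 eU] : nbhs u ((fun w : R => x + w *: v) @^-1` U).
    by apply: cl; exact: open_nbhs_nbhs.
  pose w := Num.min t (u + e / 2).
  have uw : u < w by rewrite lt_min ut ltrDl divr_gt0.
  apply: (above w); first by rewrite uw ge_min lexx.
  apply: eU; rewrite /ball /= ltr_distlC; apply/andP; split.
    by rewrite (le_lt_trans _ uw)// gerDl oppr_le0 ltW.
  rewrite gt_min ltrD2l; apply/orP; right; lra.
exists u; last first.
  split => //; split => // A /cl/nbhs_ballP[e /= e0 eA].
  have [w [/andP[w0 wt] Uw] uw] := sup_adherent e0 supS.
  exists (x + w *: v); split => //; apply: eA.
  have wu : w <= u by apply: ub_le_sup; [case: supS|split => //; rewrite w0].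
  rewrite /ball /= ltr_distlC; apply/andP; split; first exact: uw.
  by rewrite (le_lt_trans wu)// ltrDl.
rewrite ut andbT lt_neqAle u0 andbT; apply/eqP => u00.
by apply: nUu; rewrite -u00 scale0r addr0.
Qed.

End Crossing.

(** * Oblique projections *)

Section ObliqueProjection.
Context {R : realType} {m : nat}.
Variables (e : 'rV[R]_m.+1) (i : 'I_m.+1).

(** The coefficient of [e] when [x] is split into a multiple of [e] and a point of the hyperplane
    [x_i = 0]. *)
Definition height (x : 'rV[R]_m.+1) : R := x ord0 i / e ord0 i.

(* The projection along [e] onto the coordinate hyperplane [x_i = 0], identified
   with [R^m]. *)
Definition oproj (x : 'rV[R]_m.+1) : 'rV[R]_m :=
  \row_j (x ord0 (lift i j) - height x * e ord0 (lift i j)).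

Definition hyperplane (p : 'rV[R]_m) : 'rV[R]_m.+1 :=
  \row_j oapp (p ord0) 0 (unlift i j).

Lemma height_hyperplane p : height (hyperplane p) = 0.
Proof. by rewrite /height mxE unlift_none mul0r. Qed.

Lemma heightD x y : height (x + y) = height x + height y.
Proof. by rewrite /height mxE mulrDl. Qed.

Lemma heightB x y : height (x - y) = height x - height y.
Proof. by rewrite /height !mxE mulrBl. Qed.

Lemma heightZ a x : height (a *: x) = a * height x.
Proof. by rewrite /height mxE mulrA. Qed.

Lemma oprojD x y : oproj (x + y) = oproj x + oproj y.
Proof. by apply/rowP => j; rewrite !mxE heightD; ring. Qed.

Lemma oprojB x y : oproj (x - y) = oproj x - oproj y.
Proof. by apply/rowP => j; rewrite !mxE heightB; ring. Qed.

Lemma oprojZ a x : oproj (a *: x) = a *: oproj x.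
Proof. by apply/rowP => j; rewrite !mxE heightZ; ring. Qed.

Lemma oproj_hyperplane p : oproj (hyperplane p) = p.
Proof. by apply/rowP => j; rewrite !mxE height_hyperplane mul0r subr0 liftK. Qed.

Lemma norm_hyperplane p : `|hyperplane p| <= `|p|.
Proof.
apply: norm_le_coord => // j; rewrite mxE.
by case: unliftP => [k _|_] /=; rewrite ?normr0// norm_coord_le.
Qed.

Hypotheses (ei0 : e ord0 i != 0) (eimax : `|e ord0 i| = `|e|).

Lemma height_dir : height e = 1.
Proof. by rewrite /height divff. Qed.

Lemma oproj_dir : oproj e = 0.
Proof. by apply/rowP => j; rewrite !mxE height_dir mul1r subrr. Qed.

Lemma norm_dir_gt0 : 0 < `|e|.
Proof. by rewrite -eimax normr_gt0. Qed.

(** Choosing [i] as a largest coordinate of [e] makes the projection bounded independently of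
    [e]. *)
Lemma norm_height x : `|height x| * `|e| <= `|x|.
Proof.
by rewrite /height normrM normfV -eimax -mulrA mulVf ?normr_eq0// mulr1 norm_coord_le.
Qed.

Lemma norm_oproj x : `|oproj x| <= 2 * `|x|.
Proof.
apply: norm_le_coord => [|j]; first by rewrite mulr_ge0.
rewrite mxE (le_trans (ler_normB _ _))// mulr_natl mulr2n lerD ?norm_coord_le//.
by rewrite normrM (le_trans _ (norm_height x))// ler_wpM2l// norm_coord_le.
Qed.

Lemma hyperplane_oproj x : hyperplane (oproj x) = x - height x *: e.
Proof.
apply/rowP => j; rewrite !mxE; case: unliftP => [k ->|->] /=; first by rewrite mxE.
by rewrite /height divfK// subrr.
Qed.

Lemma continuous_oproj : continuous oproj.
Proof.
move=> x A /nbhs_ballP[r /= r0 rA]; apply/nbhs_ballP; exists (r / 2) => /=.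
  by rewrite divr_gt0.
move=> y; rewrite -ball_normE /= => xy; apply: rA; rewrite -ball_normE /=.
by rewrite -oprojB (le_lt_trans (norm_oproj _))// mulrC -ltr_pdivlMr.
Qed.

Lemma hausdorff_oproj (S : set 'rV[R]_m.+1) : (0 < m)%N ->
  (hausdorff m (oproj @` S) <= ((2 * m.+1%:R) ^+ m)%:E * hausdorff m S)%E.
Proof.
move=> m0; apply: hausdorff_image_le => [|x y _ _]; first by rewrite mulr_gt0.
rewrite -oprojB (le_trans (enorm_le_norm _))//.
apply: (@le_trans _ _ (m%:R * (2 * `|x - y|))).
  by rewrite ler_wpM2l// norm_oproj.
by rewrite mulrA [_ * 2]mulrC ler_pM ?mulr_ge0 ?norm_le_enorm// ler_pM2l// ler_nat.
Qed.

Lemma hausdorff_oproj0 (S : set 'rV[R]_m.+1) : (0 < m)%N ->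
  hausdorff m S = 0%E -> hausdorff m (oproj @` S) = 0%E.
Proof.
move=> m0 S0; apply/eqP; rewrite eq_le hausdorff_ge0 andbT.
by rewrite (le_trans (hausdorff_oproj _ m0))// S0 mule0.
Qed.

(* 12 comes from [hausdorff_ball_ge] and [2 * m.+1] is a Euclidean Lipschitz constant
   of [oproj]. *)
Lemma hausdorff_ge_of_oproj (S : set 'rV[R]_m.+1) (p : 'rV[R]_m) (rho : R) :
  (0 < m)%N -> 0 < rho -> (hausdorff m (ball p rho) <= hausdorff m (oproj @` S))%E ->
  (((rho / (24 * m.+1%:R)) ^+ m)%:E <= hausdorff m S)%E.
Proof.
move=> m0 rho0 pS.
have := le_trans (hausdorff_ball_ge p m0 rho0) (le_trans pS (hausdorff_oproj S m0)).
have c0 : 0 < (2 * m.+1%:R) ^+ m :> R by rewrite exprn_gt0// mulr_gt0.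
rewrite -lee_pdivrMl// -EFinM; apply: le_trans; rewrite lee_fin.
rewrite -exprVn -exprMn le_eqVlt; apply/orP; left; apply/eqP; congr (_ ^+ _).
by field; rewrite gt_eqF.
Qed.

(** The points found on the lines project onto a full ball around [oproj a]. *)
Lemma hausdorff_slab (S : set 'rV[R]_m.+1) (a : 'rV[R]_m.+1) (rho : R) :
  (0 < m)%N -> 0 < rho ->
  (forall z, `|z| < rho -> exists u, S (a + hyperplane z + u *: e)) ->
  (((rho / (24 * m.+1%:R)) ^+ m)%:E <= hausdorff m S)%E.
Proof.
move=> m0 rho0 aS; apply: (@hausdorff_ge_of_oproj _ (oproj a)) => //.
apply: subset_hausdorff => p; rewrite -ball_normE /= => ap.
have [|u Su] := aS (p - oproj a); first by rewrite distrC.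
exists (a + hyperplane (p - oproj a) + u *: e) => //.
by rewrite !oprojD oprojZ oproj_dir scaler0 addr0 oproj_hyperplane addrC subrK.
Qed.

End ObliqueProjection.

(** * Accessibility *)

Section Accessibility.
Context {R : realType} {m : nat}.
Local Notation T := 'rV[R]_m.+1.
Hypothesis m_gt0 : (0 < m)%N.
Implicit Types (x y e : T).

Definition cone e (eps : R) : set T :=
  [set w | exists2 t, 0 < t & `|w - t *: e| < eps * t].

Definition accessible (E : set T) e (eps delta : R) x : Prop :=
  forall y, E y -> `|y - x| < delta -> ~ cone e eps (y - x).

(** The two-sided corkscrew condition at [x], in the sup norm. *)
Definition two_sided (U : set T) (kappa r0 : R) x : Prop :=
  forall r, 0 < r <= r0 -> exists a b, [/\ `|a - x| <= r, `|b - x| <= r,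
    ball a (kappa * r) `<=` U & ball b (kappa * r) `<=` ~` U].

Variables (U : set T) (sigma : {measure set T -> \bar R}).
Hypothesis U_open : open U.
Local Notation E := (closure U `\` U).
Hypothesis sigma_ge : forall X, measurable X -> (hausdorff m (X `&` E) <= sigma X)%E.

Lemma dir_coord e : e != 0 ->
  exists i, e ord0 i != 0 /\ `|e ord0 i| = `|e|.
Proof.
by move=> e0; have [i ie] := norm_coord_max e0; exists i; rewrite -normr_gt0 ie normr_gt0.
Qed.

(** The segments parallel to [b - a] from the ball in [U] to the ball off [U] all cross [E] near
    [x], so [hausdorff_slab] applies. *)
Lemma ball_mass (kappa r0 r : R) x : 0 < kappa <= 1 ->
  two_sided U kappa r0 x -> 0 < r <= r0 ->
  (((kappa * r / (24 * m.+1%:R)) ^+ m)%:E <= sigma (ball x (3 * r)))%E.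
Proof.
move=> /andP[k0 k1] tx rr0; have [a [b [ax bx aU bU]]] := tx r rr0.
have /andP[r_gt0 _] := rr0.
have kr0 : 0 < kappa * r by rewrite mulr_gt0.
pose e := b - a.
have e0 : e != 0.
  apply/eqP => /subr0_eq ba; apply: (bU b); first exact: ballxx.
  by apply: aU; rewrite ba; exact: ballxx.
have [i [ei0 eimax]] := dir_coord e0.
apply: le_trans (sigma_ge _); last by apply: open_measurable_rV; exact: ball_open.
apply: (hausdorff_slab ei0 eimax (a := a)) => // z zr.
have hz := norm_hyperplane i z.
have [||u /andP[u0 u1] [Eu _]] := @last_exit _ _ U (a + hyperplane i z) e 1 U_open ler01.
- apply: aU; rewrite -ball_normE /= opprD addNKr normrN.
  exact: le_lt_trans zr.
- rewrite scale1r; apply: bU; rewrite -ball_normE /=.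
  rewrite (_ : b - _ = - hyperplane i z) ?normrN; first exact: le_lt_trans zr.
  by apply/rowP => j; rewrite !mxE; ring.
exists u; split => //; rewrite -ball_normE /=.
rewrite (_ : x - _ = - ((1 - u) *: (a - x) + u *: (b - x) + hyperplane i z)).
  rewrite normrN (le_lt_trans (ler_normD _ _))//.
  have := ler_normD ((1 - u) *: (a - x)) (u *: (b - x)).
  rewrite !normrZ (gtr0_norm u0) ger0_norm ?subr_ge0//.
  have : kappa * r <= r by rewrite ler_piMl// ltW.
  by nra.
by apply/rowP => j; rewrite !mxE; ring.
Qed.

(** Since [eps <= |e| / 2], the distance of [y] to [x] is at least [t |e| / 2], so [delta] controls
    [t]. *)
Lemma not_accessible_cone e (eps delta : R) x : 0 < eps -> eps <= `|e| / 2 ->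
  ~ accessible E e eps delta x -> exists y t,
    [/\ E y, 0 < t, `|y - x - t *: e| < eps * t & `|e| * t < 2 * delta].
Proof.
move=> eps0 epse /existsNP[y] /not_implyP[Ey] /not_implyP[yx] /contrapT[t t0 yt].
exists y, t; split => //.
have := ler_normB (y - x) (y - x - t *: e).
rewrite opprB addrC subrK normrZ (gtr0_norm t0); nra.
Qed.

Section Visible.
Variables (e : T) (i : 'I_m.+1) (h1 : R) (x : T).
Hypotheses (ei0 : e ord0 i != 0) (eimax : `|e ord0 i| = `|e|).

(* The bound [h1] ignores the part of [U] beyond the cylinder under consideration. *)
Definition below : set T :=
  [set y | exists2 u, 0 < u & U (y + u *: e) /\ height e i (y + u *: e) < h1].

(** First of the two cases: [a] is the centre of the corkscrew ball near the cone point [y]. Every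
    segment going down from this ball crosses [E] at a point below [U], and the crossing stays at
    distance of order [|e| * t] from [x]. *)
Lemma below_mass (kappa eps t : R) y a :
  0 < kappa <= 1 -> 0 < eps -> 100 * eps <= `|e| -> 0 < t ->
  height e i x + 2 * t < h1 ->
  `|y - x - t *: e| < eps * t -> `|a - y| <= eps * t ->
  ball a (kappa * (eps * t)) `<=` U ->
  (forall z, `|z| < kappa * (eps * t) -> exists2 u, 0 <= u <= t / 2 &
     ~ U (a + hyperplane i z - u *: e)) ->
  (((kappa * (eps * t) / (24 * m.+1%:R)) ^+ m)%:E <=
    hausdorff m (ball x (3 * `|e| * t) `&` below `&` E))%E.
Proof.
move=> /andP[k0 k1] eps0 epse t0 hx yx ay aU down.
have s0 : 0 < eps * t by rewrite mulr_gt0.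
have ks : kappa * (eps * t) <= eps * t by rewrite ler_piMl// ltW.
have st : 100 * (eps * t) <= `|e| * t by rewrite mulrA ler_wpM2r// ltW.
apply: (hausdorff_slab ei0 eimax (a := a)) => //; first by rewrite mulr_gt0.
move=> z zk; have hz := norm_hyperplane i z.
have Uaz : U (a + hyperplane i z).
  apply: aU; rewrite -ball_normE /= opprD addNKr normrN.
  exact: le_lt_trans zk.
have [u /andP[u0 ut] nU] := down z zk.
have [|v /andP[v0 vu] [Ev _]] := last_exit U_open u0 Uaz (v := - e).
  by rewrite scalerN.
exists (- v); rewrite scaleNr -scalerN; split => //; split.
- rewrite -ball_normE /= (_ : x - _ = - ((y - x - t *: e) + (a - y) +
      hyperplane i z + (t - v) *: e)); last first.
    by apply/rowP => j; rewrite !mxE; ring.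
  rewrite normrN (le_lt_trans (ler_normD _ _))//.
  have := ler_normD ((y - x - t *: e) + (a - y)) (hyperplane i z).
  have := ler_normD (y - x - t *: e) (a - y).
  rewrite [`|(t - v) *: e|]normrZ ger0_norm; last by lra.
  have : (t - v) * `|e| <= t * `|e| by rewrite ler_wpM2r//; lra.
  have : 0 < `|e| * t by rewrite mulr_gt0// (norm_dir_gt0 ei0 eimax).
  by lra.
(* The upper end of the segment lies in [U] at height at most [height e i x + 2 * t], so it
   witnesses that the crossing is in [below]. *)
- exists v => //; rewrite scalerN subrK; split => //.
  rewrite heightD height_hyperplane addr0.
  pose w := (y - x - t *: e) + (a - y).
  have -> : a = x + t *: e + w by apply/rowP => j; rewrite !mxE; ring.
  have : height e i w <= t.
    apply: le_trans (ler_norm _) _; have e0 := norm_dir_gt0 ei0 eimax.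
    rewrite -(ler_pM2r e0) (le_trans (norm_height ei0 eimax _))//.
    have := ler_normD (y - x - t *: e) (a - y); rewrite -/w; lra.
  by rewrite !heightD heightZ height_dir// mulr1; lra.
Qed.

(** Second case: a segment displaced by [w] stays in [U], while the points straight above [x] at the
    same heights are off [U] because [x] is not in [below]. The crossings between the two carry [J]
    disjoint balls, each with the mass of [ball_mass]. *)
Lemma tube_mass (kappa r0 rho1 eps t : R) (J : nat) (w : T) :
  0 < kappa <= 1 -> 0 < eps -> 100 * eps <= `|e| -> 24 * J%:R * eps <= `|e| ->
  0 < t -> height e i x + 2 * t < h1 -> eps * t <= r0 -> 2 * `|e| * t <= rho1 ->
  (forall y, E y -> `|y - x| < rho1 -> two_sided U kappa r0 y) ->
  ~ below x -> `|w| <= 3 * (eps * t) ->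
  (forall u, 0 <= u <= t / 2 -> U (x + t *: e + w - u *: e)) ->
  ((J%:R * (kappa * (eps * t) / (24 * m.+1%:R)) ^+ m)%:E <=
    sigma (oproj e i @^-1` ball (oproj e i x) (13 * (eps * t)) `&` ball x (2 * `|e| * t)))%E.
Proof.
move=> k01 eps0 epse epsJ t0 hx tr0 trho tx nbx w3 Uw.
set s := eps * t in tr0 w3 *.
have s0 : 0 < s by rewrite mulr_gt0.
have st : 100 * s <= `|e| * t by rewrite mulrA ler_wpM2r// ltW.
have e0 := norm_dir_gt0 ei0 eimax.
(* The marks [x + th j *: e] are [12 s] apart, and each point of [E] chosen is within [3 s] of its
   mark, so the balls of radius [3 s] about these points are disjoint. The bound on [24 * J * eps]
   keeps [th j] between [t / 2] and [t]. *)
pose th (j : 'I_J) := t / 2 + j%:R * (12 * s / `|e|).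
have thlo j : t / 2 <= th j by rewrite lerDl mulr_ge0// divr_ge0// mulr_ge0// ltW.
have thhi j : th j <= t.
  have : j%:R * (12 * s / `|e|) <= t / 2; last by rewrite /th; lra.
  rewrite mulrA ler_pdivrMr//; apply: (@le_trans _ _ (J%:R * (12 * s))).
    by rewrite ler_wpM2r ?ler_nat ?(ltnW (ltn_ord j))// mulr_ge0// ltW.
  have : 24 * J%:R * eps * t <= `|e| * t by rewrite ler_wpM2r// ltW.
  by rewrite /s; lra.
(* The segment from [x + th j *: e + w] in [U] to [x + th j *: e] off [U] crosses [E]. *)
have /choice[Y YP] (j : 'I_J) : exists y, E y /\ `|y - (x + th j *: e)| <= 3 * s.
  have Ux : U (x + th j *: e + w).
    rewrite (_ : x + _ + w = x + t *: e + w - (t - th j) *: e); last first.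
      by apply/rowP => k; rewrite !mxE; ring.
    by apply: Uw; apply/andP; have := thlo j; have := thhi j; split; lra.
  have nUx : ~ U (x + th j *: e + w + 1 *: - w).
    rewrite scale1r addrK => Uth; apply: nbx; exists (th j); first by have := thlo j; lra.
    by split => //; rewrite heightD heightZ height_dir// mulr1; have := thhi j; lra.
  have [u /andP[u0 u1] [Eu _]] := last_exit U_open ler01 Ux nUx.
  exists (x + th j *: e + w + u *: - w); split => //.
  rewrite (_ : _ - _ = (1 - u) *: w); last by apply/rowP => k; rewrite !mxE; ring.
  rewrite normrZ ger0_norm ?subr_ge0// (le_trans _ w3)// ler_piMl//.
  by rewrite gerBl ltW.
have YE j : E (Y j) by have [] := YP j.
have mY j : measurable (ball (Y j) (3 * s)).
  by apply: open_measurable_rV; exact: ball_open.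
have Yx j : `|Y j - x| <= `|e| * t + 3 * s.
  rewrite (_ : Y j - x = (Y j - (x + th j *: e)) + th j *: e); last first.
    by apply/rowP => k; rewrite !mxE; ring.
  rewrite (le_trans (ler_normD _ _))// addrC lerD//; last by have [] := YP j.
  rewrite normrZ mulrC ler_wpM2l// ger0_norm//.
  by have := thlo j; lra.
have massY j : (((kappa * s / (24 * m.+1%:R)) ^+ m)%:E <= sigma (ball (Y j) (3 * s)))%E.
  apply: (@ball_mass kappa r0) => //; last by rewrite s0.
  by apply: tx => //; apply: le_lt_trans (Yx j) _; lra.
have trivY : trivIset setT (fun j => ball (Y j) (3 * s)).
  move=> j k _ _ [y []]; rewrite -!ball_normE /= => jy ky; apply/eqP/contraT => jk.
  have [_ Yj] := YP j; have [_ Yk] := YP k.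
  have : 12 * s <= `|(th j - th k) *: e|.
    pose q := 12 * s / `|e|.
    have q0 : 0 <= q by rewrite divr_ge0// mulr_ge0// ltW.
    have qe : q * `|e| = 12 * s by rewrite divfK// gt_eqF.
    rewrite (_ : th j - th k = (j%:R - k%:R) * q); last by rewrite /th -/q; ring.
    rewrite normrZ normrM (ger0_norm q0) -mulrA qe ler_peMl//.
      by rewrite mulr_ge0// ltW.
    have : (j : nat) != k by [].
    rewrite neq_ltn => /orP[jk'|kj].
      by rewrite distrC ger0_norm -natrB ?(ltnW jk')// ler1n subn_gt0.
    by rewrite ger0_norm -natrB ?(ltnW kj)// ler1n subn_gt0.
  rewrite (_ : _ *: e = - (Y j - (x + th j *: e)) + (Y j - y) +
      (- (Y k - y) + (Y k - (x + th k *: e)))); last first.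
    by apply/rowP => l; rewrite !mxE; ring.
  have := ler_normD (- (Y j - (x + th j *: e)) + (Y j - y))
    (- (Y k - y) + (Y k - (x + th k *: e))).
  have := ler_normD (- (Y j - (x + th j *: e))) (Y j - y).
  have := ler_normD (- (Y k - y)) (Y k - (x + th k *: e)).
  by rewrite !normrN; lra.
apply: (@le_trans _ _ (\sum_(j < J) sigma (ball (Y j) (3 * s)))%E).
  apply: (@le_trans _ _ (\sum_(j < J) ((kappa * s / (24 * m.+1%:R)) ^+ m)%:E)%E).
    by rewrite sumEFin sumr_const card_ord mulr_natl.
  by apply: lee_sum => j _; exact: massY.
rewrite -(measure_semi_additive_ord sigma mY trivY); last first.
  exact: bigsetU_measurable.
apply: le_measure; rewrite ?inE.
- exact: bigsetU_measurable.
- apply: measurableI; apply: open_measurable_rV; last exact: ball_open.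
  apply: open_comp; last exact: ball_open.
  by move=> y _; exact: continuous_oproj.
rewrite -bigcup_seq => y [j _]; rewrite -!ball_normE /= => Yy.
have [_ Yj] := YP j; split.
(* [e] projects to 0 and [oproj] at most doubles norms, so the distance is less than
   [2 * (3 s + 3 s) = 12 s]. *)
- rewrite -oprojB (_ : x - y = - (Y j - (x + th j *: e)) + (Y j - y) - th j *: e).
    rewrite oprojB oprojZ oproj_dir// scaler0 subr0.
    rewrite (le_lt_trans (norm_oproj ei0 eimax _))//.
    by have := ler_normD (- (Y j - (x + th j *: e))) (Y j - y); rewrite normrN; lra.
  by apply/rowP => k; rewrite !mxE; ring.
- rewrite (_ : x - y = - (Y j - x) + (Y j - y)); last first.
    by apply/rowP => k; rewrite !mxE; ring.
  rewrite (le_lt_trans (ler_normD _ _))// normrN.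
  by have := Yx j; lra.
Qed.

Lemma open_below : open below.
Proof.
pose V := U `&` [set y | height e i y < h1].
have -> : below = \bigcup_(u in [set u : R | 0 < u]) (fun y => y + u *: e) @^-1` V.
  by apply/seteqP; split => y [u u0 ?]; exists u.
apply: bigcup_open => u _; apply: open_comp.
  move=> y _; have F := nbhs_filter y.
  by apply: (@cvgD _ _ _ (nbhs y) F id (fun=> u *: e)); [exact: cvg_id|exact: cvg_cst].
apply: openI => //; rewrite openE => y /= yh.
apply/nbhs_ballP; exists ((h1 - height e i y) * `|e|) => /=.
  by rewrite mulr_gt0 ?subr_gt0// (norm_dir_gt0 ei0 eimax).
move=> z; rewrite -ball_normE /= distrC.
move=> /(le_lt_trans (norm_height ei0 eimax _)).
rewrite ltr_pM2r ?(norm_dir_gt0 ei0 eimax)// heightB.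
by move=> /(le_lt_trans (ler_norm _)); lra.
Qed.

(** A point of [E] in a thin cone over [x] leads to one of the two cases: the first contradicts the
    density hypothesis on [below], the second the one on the tube. *)
Lemma visible_accessible (kappa r0 rho1 t0 d0 : R) (K : set T) :
  0 < kappa <= 1 -> 0 < r0 -> 0 < rho1 -> 0 < t0 -> 0 < d0 ->
  measurable K -> ball x rho1 `<=` K -> height e i x < h1 -> ~ below x ->
  (forall y, E y -> `|y - x| < rho1 -> two_sided U kappa r0 y) ->
  (forall r, 0 < r < d0 -> ~ ((t0 * r ^+ m)%:E <=
     sigma (oproj e i @^-1` ball (oproj e i x) r `&` K))%E) ->
  (forall t, 0 < t -> exists2 d, 0 < d & forall r, 0 < r < d ->
     ~ ((t * r ^+ m)%:E <= sigma (ball x r `&` below))%E) ->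
  exists eps delta, [/\ 0 < eps, 0 < delta & accessible E e eps delta x].
Proof.
move=> k01 r00 rho10 t00 d00 mK xK hx nbx tx tube nobelow.
have /andP[k0 k1] := k01; have e0 := norm_dir_gt0 ei0 eimax.
pose c := kappa / (24 * m.+1%:R).
have c0 : 0 < c by rewrite divr_gt0// mulr_gt0.
(* Chosen so that [J] balls of mass [(c s)^m] reach [t0 * (13 s)^m], the mass excluded for the tube
   of radius [13 s]. *)
pose J := (Num.trunc (t0 * 13 ^+ m / c ^+ m)).+1.
have Jc : t0 * 13 ^+ m <= J%:R * c ^+ m.
  by rewrite -ler_pdivrMr ?exprn_gt0// ltW// truncnS_gt.
pose eps := `|e| / (100 * J%:R).
have J1 : 1 <= J%:R :> R by rewrite ler1n.
have epsJ : 100 * J%:R * eps = `|e|.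
  by rewrite /eps mulrC divfK// mulf_neq0// gt_eqF// (lt_le_trans ltr01).
have eps0 : 0 < eps by rewrite divr_gt0// mulr_gt0.
have epsJ' : eps <= J%:R * eps by rewrite ler_peMl// ltW.
have epse : 100 * eps <= `|e| by lra.
have epse' : 24 * J%:R * eps <= `|e| by lra.
(* At radius [3 * |e| * t] this threshold reads [(c * eps * t)^m], the mass given by
   [below_mass]. *)
have [|d1 d10 nob] := nobelow ((c * eps / (3 * `|e|)) ^+ m).
  by rewrite exprn_gt0// divr_gt0// mulr_gt0.
pose h := (h1 - height e i x) * `|e|.
have h0 : 0 < h by rewrite mulr_gt0// subr_gt0.
(* [M] respects every scale limit of the hypotheses; [h] turns the height margin under [h1] into a
   length. *)
pose M := Num.min (Num.min r0 rho1) (Num.min (Num.min d0 d1) h).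
have M0 : 0 < M by rewrite !lt_min r00 rho10 d00 d10 h0.
have := lexx M; rewrite {2}/M !le_min => /andP[/andP[Mr Mrho] /andP[/andP[Md0 Md1] Mh]].
exists eps, (M / 8); split; [by []|by rewrite divr_gt0|].
apply: contrapT => /not_accessible_cone[//||y [t [Ey tt yx te]]]; first by lra.
have {}te : `|e| * t < M / 4 by lra.
pose s := eps * t.
have s0 : 0 < s by rewrite mulr_gt0.
have st : 100 * s <= `|e| * t by rewrite mulrA ler_wpM2r// ltW.
have ht : height e i x + 2 * t < h1.
  by rewrite -ltrBrDl -(ltr_pM2r e0) -/h; lra.
have yrho : `|y - x| < rho1.
  rewrite (_ : y - x = (y - x - t *: e) + t *: e); last by rewrite subrK.
  rewrite (le_lt_trans (ler_normD _ _))// normrZ (gtr0_norm tt).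
  by rewrite -/s in yx; lra.
have [|a [b [ya _ aU _]]] := tx y Ey yrho s; first by rewrite s0/=; lra.
have cs : kappa * s / (24 * m.+1%:R) = c * s by rewrite /c; ring.
(* The dichotomy: either all segments down from the corkscrew ball leave [U], or one of them stays
   in [U]. *)
have [down|] := pselect (forall z : 'rV[R]_m, `|z| < kappa * s ->
    exists2 u, 0 <= u <= t / 2 & ~ U (a + hyperplane i z - u *: e)).
  apply: (nob (3 * `|e| * t)).
    by rewrite mulr_gt0 ?mulr_gt0//=; lra.
  have := below_mass k01 eps0 epse tt ht yx ya aU down.
  rewrite cs; have -> : (c * eps / (3 * `|e|)) ^+ m * (3 * `|e| * t) ^+ m = (c * s) ^+ m.
    by rewrite -exprMn; congr (_ ^+ _); rewrite /s; field; rewrite gt_eqF.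
  move=> /le_trans; apply; apply: sigma_ge; apply: measurableI.
    by apply: open_measurable_rV; exact: ball_open.
  by apply: open_measurable_rV; exact: open_below.
move=> /existsNP[z /not_implyP[zk /forall2NP nU]].
have hz := norm_hyperplane i z.
have ks : kappa * s <= s by rewrite ler_piMl// ltW.
pose w := a + hyperplane i z - x - t *: e.
have w3 : `|w| <= 3 * s.
  rewrite (_ : w = (y - x - t *: e) + (a - y) + hyperplane i z); last first.
    by apply/rowP => j; rewrite !mxE; ring.
  rewrite (le_trans (ler_normD _ _))//.
  have := ler_normD (y - x - t *: e) (a - y).
  by rewrite -/s in yx ya; lra.
have Uw u : 0 <= u <= t / 2 -> U (x + t *: e + w - u *: e).
  move=> ut; have [//|/contrapT] := nU u.
  rewrite (_ : x + t *: e + w = a + hyperplane i z)//.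
  by apply/rowP => j; rewrite !mxE; ring.
have tr0 : eps * t <= r0 by rewrite -/s; lra.
have trho : 2 * `|e| * t <= rho1 by lra.
have := tube_mass k01 eps0 epse epse' tt ht tr0 trho tx nbx w3 Uw.
rewrite -/s cs; apply: contra_not (tube (13 * s) _) => [h'|]; last first.
  by rewrite mulr_gt0//=; lra.
apply: le_trans (le_trans _ h') _.
  rewrite lee_fin [(13 * s) ^+ m]exprMn [(c * s) ^+ m]exprMn.
  by rewrite mulrA [leRHS]mulrA ler_wpM2r// exprn_ge0// ltW.
have mtube : measurable (oproj e i @^-1` ball (oproj e i x) (13 * s)).
  apply: open_measurable_rV; apply: open_comp; last exact: ball_open.
  by move=> ? _; exact: continuous_oproj.
apply: le_measure; rewrite ?inE.
- apply: measurableI => //; apply: open_measurable_rV; exact: ball_open.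
- exact: measurableI.
- by move=> v [? vx]; split => //; apply: xK; apply: le_ball vx.
Qed.

End Visible.
End Accessibility.

(** * Sets without pairs of points in a cone lie on Lipschitz graphs *)

Section LipschitzGraphs.
Context {R : realType}.

(* McShane's extension, one coordinate at a time. *)
Lemma lipschitz_section_extension (m n : nat) (S : set 'rV[R]_n)
    (pr : 'rV[R]_n -> 'rV[R]_m) (L : R) : 0 <= L ->
  (forall x y, S x -> S y -> `|x - y| <= L * `|pr x - pr y|) ->
  exists f : 'rV[R]_m -> 'rV[R]_n,
    (exists L', forall p q, enorm (f p - f q) <= L' * enorm (p - q)) /\
    S `<=` range f.
Proof.
move=> L0 SL; have [[x0 Sx0]|S0] := pselect (S !=set0); last first.
  exists (fun=> 0); split; last by move=> x Sx; case: S0; exists x.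
  exists 1 => p q; rewrite subrr mul1r (le_trans (enorm_le_norm _))//.
  by rewrite normr0 mulr0 sqrtr_ge0.
pose G j p := [set x ord0 j + L * `|p - pr x| | x in S].
have Glow j p x : S x -> lbound (G j p) (x ord0 j - L * `|p - pr x|).
  move=> Sx _ [y Sy <-].
  have := SL x y Sx Sy; have := norm_coord_le (x - y) j; rewrite !mxE.
  have : L * `|pr x - pr y| <= L * `|p - pr x| + L * `|p - pr y|.
    by rewrite -mulrDr ler_wpM2l// (distrC p (pr x)) ler_distD.
  have := ler_norm (x ord0 j - y ord0 j); lra.
have infG j p : has_inf (G j p).
  split; first by exists (x0 ord0 j + L * `|p - pr x0|), x0.
  by exists (x0 ord0 j - L * `|p - pr x0|); exact: Glow.
pose f p : 'rV[R]_n := \row_j inf (G j p).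
have fL j p q : inf (G j p) <= inf (G j q) + L * `|p - q|.
  rewrite -lerBlDr; apply: lb_le_inf; first by case: (infG j q).
  move=> _ [x Sx <-]; rewrite lerBlDr.
  apply: (@le_trans _ _ (x ord0 j + L * `|p - pr x|)).
    by apply: ge_inf; [case: (infG j p)|exists x].
  by rewrite -addrA lerD2l -mulrDr ler_wpM2l// [leRHS]addrC ler_distD.
exists f; split.
  exists (n%:R * L) => p q; rewrite (le_trans (enorm_le_norm _))// -mulrA ler_wpM2l//.
  apply: (@le_trans _ _ (L * `|p - q|)); last by rewrite ler_wpM2l// norm_le_enorm.
  apply: norm_le_coord => [|j]; first by rewrite mulr_ge0.
  rewrite !mxE ler_norml.
  by have := fL j p q; have := fL j q p; rewrite (distrC q p); lra.
move=> x Sx; exists (pr x) => //; apply/rowP => j; rewrite mxE; apply/eqP.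
rewrite eq_le; apply/andP; split.
  apply: ge_inf; first by case: (infG j (pr x)).
  by exists x => //; rewrite subrr normr0 mulr0 addr0.
apply: lb_le_inf; first by case: (infG j (pr x)).
by have := Glow j (pr x) x Sx; rewrite subrr normr0 mulr0 subr0.
Qed.

(* [cone 0 eps] is the whole space, so that [S] is empty if [e = 0]. *)
Lemma cone_free_lipschitz (m : nat) (S : set 'rV[R]_m.+1) (e : 'rV[R]_m.+1)
    (eps : R) : 0 < eps -> (forall x y, S x -> S y -> ~ cone e eps (y - x)) ->
  exists f : 'rV[R]_m -> 'rV[R]_m.+1,
    (exists L', forall p q, enorm (f p - f q) <= L' * enorm (p - q)) /\
    S `<=` range f.
Proof.
move=> eps0 Scone; have [e0|e0] := eqVneq e 0.
  apply: (@lipschitz_section_extension _ _ _ (fun=> 0) 0) => // x y Sx Sy.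
  case: (Scone x x Sx Sx); exists 1 => //.
  by rewrite e0 subrr scaler0 subr0 normr0 mulr1.
have [i [ei0 eimax]] := dir_coord e0.
apply: (@lipschitz_section_extension _ _ _ (oproj e i) (`|e| / eps + 1)).
  by rewrite addr_ge0// divr_ge0// ltW.
(* Otherwise [x - y] would lie in the cone. Used in both orders, this bounds the absolute height
   difference by the projected distance over [eps]. *)
have key x y : S x -> S y -> eps * height e i (x - y) <= `|oproj e i (x - y)|.
  move=> Sx Sy; have [h0|h0] := leP (height e i (x - y)) 0.
    by rewrite (le_trans _ (normr_ge0 _))// mulr_ge0_le0// ltW.
  rewrite leNgt; apply/negP => lth; apply: (Scone y x Sy Sx).
  exists (height e i (x - y)) => //; rewrite -(hyperplane_oproj ei0).
  exact: le_lt_trans (norm_hyperplane _ _) lth.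
move=> x y Sx Sy; rewrite -oprojB mulrDl mul1r.
rewrite -{1}(subrK (height e i (x - y) *: e) (x - y)) -(hyperplane_oproj ei0).
rewrite (le_trans (ler_normD _ _))// addrC lerD ?norm_hyperplane// normrZ.
rewrite mulrC -mulrA ler_wpM2l// mulrC ler_pdivlMr// mulrC.
have := key x y Sx Sy; have := key y x Sy Sx.
rewrite -(opprB x y) -scaleN1r heightZ oprojZ normrZ normrN1 !mul1r mulN1r => k1 k2.
by rewrite -[X in X * _]gtr0_norm// -normrM ler_norml; apply/andP; split; lra.
Qed.

End LipschitzGraphs.

(** * Rectifiability of two-sided boundaries *)

Section TwoSidedBoundary.
Context {R : realType} {m : nat}.
Local Notation T := 'rV[R]_m.+1.
Hypothesis m_gt0 : (0 < m)%N.
Variables (U : set T) (sigma : {measure set T -> \bar R}).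
Hypothesis U_open : open U.
Local Notation E := (closure U `\` U).
Hypothesis sigma_ge : forall X, measurable X -> (hausdorff m (X `&` E) <= sigma X)%E.
Hypothesis sigma_fin : forall (x : T) (r : R), (sigma (ball x r) < +oo)%E.
Hypothesis sigma_outer : forall (A : set T) (eps : R), measurable A ->
  bounded_set A -> 0 < eps ->
  exists W : set T, [/\ open W, A `<=` W & (sigma (W `\` A) <= eps%:E)%E].

(** The last points of [E] on the segments from one corkscrew ball to the other project onto a ball.
    Up to a null set of projections they are accessible, hence off [Z], and this bounds the measure
    of [E] off [Z] from below. *)
Lemma accessible_density (Z : set T) (x : T) (kappa r0 rho1 r : R) :
  measurable Z -> Z `<=` E ->
  (forall y (q : 'rV[rat]_m.+1) (eps delta : R), 0 < eps -> 0 < delta ->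
     accessible E (map_mx ratr q) eps delta y -> ~ Z y) ->
  0 < kappa <= 1 -> E x -> 0 < rho1 ->
  (forall y, E y -> `|y - x| < rho1 -> two_sided U kappa r0 y) ->
  0 < r -> r <= r0 -> 10 * r <= rho1 ->
  (((kappa * r / 2 / (24 * m.+1%:R)) ^+ m)%:E <= sigma (ball x (5 * r) `\` Z))%E.
Proof.
move=> mZ ZE Zacc k01 Ex rho10 tx rp rr0 rrho.
have /andP[k0 k1] := k01.
have [||a [b [ax bx aU bU]]] := tx x Ex _ r; [by rewrite subrr normr0|by rewrite rp|].
pose rho := kappa * r / 2.
have kr0 : 0 < kappa * r by rewrite mulr_gt0.
have kr : kappa * r <= r by rewrite ler_piMl// ltW.
have rho0 : 0 < rho by rewrite divr_gt0.
(* [Zacc] speaks of rational directions. The factor 2 in [rho] absorbs the approximation error, so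
   that translates by [e] of points near [a] still fall into the ball about [b]. *)
have [q] := rational_dense (b - a) rho0.
set e := map_mx ratr q => be.
have aU' z : `|z| < rho -> U (a + z).
  move=> zr; apply: aU; rewrite -ball_normE /= opprD addNKr normrN.
  by apply: lt_trans zr _; rewrite /rho; lra.
have bU' z : `|z| < rho -> ~ closure U (a + z + e).
  move=> zr /(_ (ball b (kappa * r))) [|y [Uy /bU//]].
  apply: open_nbhs_nbhs; split; first exact: ball_open.
  rewrite -ball_normE /= (_ : b - _ = b - a - e - z); last first.
    by apply/rowP => j; rewrite !mxE; ring.
  by have := ler_normB (b - a - e) z; rewrite /rho in be zr; lra.
have e0 : e != 0.
  apply/eqP => e0; apply: (bU' 0); first by rewrite normr0.
  by apply: subset_closure; rewrite e0 !addr0 -[a]addr0; apply: aU'; rewrite normr0.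
have [i [ei0 eimax]] := dir_coord e0.
have e3 : `|e| <= 3 * r.
  rewrite (_ : e = (b - x) - (a - x) - (b - a - e)); last first.
    by apply/rowP => j; rewrite !mxE; ring.
  have := ler_normB ((b - x) - (a - x)) (b - a - e).
  by have := ler_normB (b - x) (a - x); rewrite /rho in be; lra.
(* [e] has height 1, so the segments from the disc around [a] end exactly at height [h1]. *)
pose h1 := height e i a + 1.
pose G := below U e i h1.
have oG : open G by exact: open_below.
pose A := ~` G.
have mA : measurable A by apply: measurableC; exact: open_measurable_rV.
have GA y r' : ball y r' `\` A = ball y r' `&` G by rewrite setDE setCK.
(* The two exceptional sets: [N1] where [G] has positive upper density, and [P0] where the projected
   measure has infinite upper density. *)
pose N1 := [set y | A y /\ exists2 t : R, 0 < t & forall delta : R, 0 < delta ->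
    exists2 r : R, 0 < r < delta & ((t * r ^+ m)%:E <= sigma (ball y r `\` A))%E].
have N10 : hausdorff m N1 = 0%E by exact: hausdorff_outer_density.
pose K : set T := ball x rho1.
have mK : measurable K by apply: open_measurable_rV; exact: ball_open.
pose P0 := [set p : 'rV[R]_m | forall t delta : R, 0 < t -> 0 < delta ->
    exists2 r : R, 0 < r < delta &
      ((t * r ^+ m)%:E <= sigma (oproj e i @^-1` ball p r `&` K))%E].
have P00 : hausdorff m P0 = 0%E.
  by apply: hausdorff_infinite_density => //; [exact: continuous_oproj|exact: sigma_fin].
pose S := (ball x (5 * r) `\` Z) `&` E.
have mS : measurable (ball x (5 * r) `\` Z).
  by apply: measurableD => //; apply: open_measurable_rV; exact: ball_open.
apply: le_trans (sigma_ge mS); apply: (hausdorff_ge_of_oproj ei0 eimax (p := oproj e i a)) => //.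
have cover : ball (oproj e i a) rho `<=` oproj e i @` S `|` (P0 `|` oproj e i @` N1).
  move=> p; rewrite -ball_normE /= distrC => pz.
  set z := p - oproj e i a in pz.
  have hz : `|hyperplane i z| < rho := le_lt_trans (norm_hyperplane i z) pz.
  have [|u /andP[u0 u1] [Eu above]] := last_exit U_open ler01 (aU' _ hz) (v := e).
    by rewrite scale1r => /subset_closure; exact: bU'.
  set y := a + hyperplane i z + u *: e in Eu.
  have yp : oproj e i y = p.
    rewrite !oprojD oprojZ oproj_dir// scaler0 addr0 oproj_hyperplane.
    by rewrite addrC subrK.
  have hy : height e i y = height e i a + u.
    by rewrite !heightD height_hyperplane heightZ height_dir// mulr1 addr0.
  have {}u1 : u < 1.
    rewrite lt_neqAle u1 andbT; apply/eqP => u1'.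
    by apply: (bU' _ hz); case: Eu; rewrite /y u1' scale1r.
  have nGy : ~ G y.
    move=> [v v0]; rewrite heightD heightZ height_dir// mulr1 hy => -[Uv hv].
    apply: (above (u + v)); last by rewrite scalerDl addrA.
    by rewrite /h1 in hv; apply/andP; split; lra.
  have yx : `|x - y| < 5 * r.
    rewrite (_ : x - y = - ((a - x) + hyperplane i z + u *: e)); last first.
      by apply/rowP => j; rewrite !mxE; ring.
    rewrite normrN (le_lt_trans (ler_normD _ _))// normrZ (gtr0_norm u0).
    have : u * `|e| <= `|e| by rewrite ler_piMl// ltW.
    by have := ler_normD (a - x) (hyperplane i z); rewrite /rho in hz; lra.
  have [Pp|nPp] := pselect (P0 p); first by right; left.
  have [Ny|nNy] := pselect (N1 y); first by right; right; exists y.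
  left; exists y => //; split => //; split; first by rewrite -ball_normE.
  have [t0 [d0 [t00 d00 tube]]] : exists t0 d0, [/\ 0 < t0, 0 < d0 &
      forall r, 0 < r < d0 -> ~ ((t0 * r ^+ m)%:E <=
       sigma (oproj e i @^-1` ball (oproj e i y) r `&` K))%E].
    move: nPp => /existsNP[t0 /existsNP[d0 /not_implyP[t00 /not_implyP[d00]]]].
    move=> /forall2NP tube; exists t0, d0; split => // r' rd.
    by rewrite yp; have [//|] := tube r'.
  have nob (t : R) : 0 < t -> exists2 d : R, 0 < d & forall r, 0 < r < d ->
      ~ ((t * r ^+ m)%:E <= sigma (ball y r `&` G))%E.
    move=> t1; apply: contrapT => /forall2NP nd; apply: nNy; split => //.
    exists t => // delta delta0; have [//|/existsNP[r' /not_implyP[rd /contrapT]]] := nd delta.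
    by rewrite -GA => ?; exists r'.
  (* [|x - y| < 5 * r] and [10 * r <= rho1] leave the radius [rho1 / 2] about [y]. *)
  have yK : ball y (rho1 / 2) `<=` K.
    move=> w; rewrite /K -!ball_normE /= => yw.
    by have := ler_distD y x w; lra.
  have [||eps [delta [eps0 delta0 acc]]] := visible_accessible m_gt0 U_open sigma_ge
    ei0 eimax k01 (lt_le_trans rp rr0) (divr_gt0 rho10 (ltr0n _ 2)) t00 d00 mK yK _ nGy _ tube nob.
  - by rewrite hy /h1 ltrD2l.
  - move=> w Ew wy; apply: tx => //.
    by have := ler_distD y w x; rewrite (distrC y x); lra.
  exact: Zacc acc.
apply: le_trans (subset_hausdorff m cover) _.
apply: le_trans (hausdorffU m_gt0 _ _) _.
rewrite -[leRHS]adde0 leeD2l//; apply: le_trans (hausdorffU m_gt0 _ _) _.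
by rewrite P00 add0e hausdorff_oproj0.
Qed.

(** Countably many pieces, indexed by a rational direction, an integer for aperture and reach, and a
    rational centre, lie on Lipschitz graphs and exhaust the accessible points; the remainder [Z] is
    null by density. *)
Lemma rectifiable_two_sided :
  (forall x, E x -> exists kappa r0 rho1, [/\ 0 < kappa <= 1, 0 < r0, 0 < rho1 &
     forall y, E y -> `|y - x| < rho1 -> two_sided U kappa r0 y]) ->
  rectifiable m E.
Proof.
move=> corkscrews.
have mE : measurable E.
  apply: measurableD; last exact: open_measurable_rV.
  rewrite -[closure U]setCK; apply: measurableC; apply: open_measurable_rV.
  exact/closed_openC/closed_closure.
pose I : Type := ('rV[rat]_m.+1 * nat * 'rV[rat]_m.+1)%type.
pose piece (j : I) : set T := let: (q, k, c) := j in
  [set x | [/\ E x, accessible E (map_mx ratr q) k.+1%:R^-1 k.+1%:R^-1 x &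
             ball (map_mx ratr c : T) (k.+1%:R^-1 / 2) x]].
have mpiece j : measurable (piece j).
  move: j => [[q k] c] /=.
  set e := map_mx ratr q; set d := k.+1%:R^-1.
  (* [G] is the open set of points with some [y] of [E] in their cone within distance [d];
     accessibility is membership in its complement. *)
  pose G := \bigcup_(y in E) \bigcup_(t in [set t : R | 0 < t])
    (ball y d `&` ball (y - t *: e) (d * t)).
  rewrite (_ : [set x | _] = E `&` ~` G `&` ball (map_mx ratr c : T) (d / 2)).
    apply: measurableI; last by apply: open_measurable_rV; exact: ball_open.
    apply: measurableI => //; apply: measurableC; apply: open_measurable_rV.
    apply: bigcup_open => y _; apply: bigcup_open => t _.
    by apply: openI; exact: ball_open.
  apply/seteqP; split => x /=.
  - move=> [Ex acc xc]; split => //; split => // -[y Ey [t t0 []]].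
    rewrite -!ball_normE /= addrAC => yx yt.
    by apply: (acc y Ey yx); exists t.
  - move=> [[Ex nG] xc]; split => // y Ey yx [t t0 yt]; apply: nG.
    by exists y => //; exists t => //; rewrite -!ball_normE /= addrAC.
pose piece_ (N : nat) : set T := oapp piece set0 (unpickle N).
have mpiece_ N : measurable (piece_ N).
  by rewrite /piece_; case: unpickle => [j|] //=; exact: mpiece.
pose Z := E `\` \bigcup_N piece_ N.
have mZ : measurable Z by apply: measurableD => //; exact: bigcup_measurable.
have Zacc y (q : 'rV[rat]_m.+1) (eps delta : R) : 0 < eps -> 0 < delta ->
    accessible E (map_mx ratr q) eps delta y -> ~ Z y.
  move=> eps0 delta0 acc [Ey]; apply.
  pose k := maxn (Num.trunc eps^-1) (Num.trunc delta^-1).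
  have keps : k.+1%:R^-1 <= eps.
    rewrite -[leRHS]invrK lef_pV2 ?posrE ?invr_gt0//.
    by rewrite (le_trans (ltW (truncnS_gt _)))// ler_nat ltnS leq_maxl.
  have kdelta : k.+1%:R^-1 <= delta.
    rewrite -[leRHS]invrK lef_pV2 ?posrE ?invr_gt0//.
    by rewrite (le_trans (ltW (truncnS_gt _)))// ler_nat ltnS leq_maxr.
  have [|c yc] := @rational_dense _ _ y (k.+1%:R^-1 / 2); first by rewrite divr_gt0.
  exists (pickle (q, k, c)) => //; rewrite /piece_ pickleK /=; split => //; last first.
    by rewrite -ball_normE /= distrC.
  move=> z Ez zy [t t0 zt]; apply: (acc z Ez (lt_le_trans zy kdelta)).
  by exists t => //; apply: lt_le_trans zt _; rewrite ler_pM2r.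
(* For all small [r] the set [ball x (5 * r)] minus [Z] has mass at least a constant times [r^m], so
   [Z] lies in the null set of [hausdorff_outer_density]. *)
have Z0 : hausdorff m Z = 0%E.
  apply: subset_hausdorff0 (hausdorff_outer_density m_gt0 sigma_outer mZ).
  move=> x Zx; have Ex : E x by case: Zx.
  split => //; have [kappa [r0 [rho1 [k01 r00 rho10 tx]]]] := corkscrews x Ex.
  have k0 : 0 < kappa by case/andP: k01.
  exists ((kappa / 2 / (24 * m.+1%:R) / 5) ^+ m).
    by rewrite exprn_gt0// !divr_gt0// mulr_gt0.
  move=> delta delta0; pose r := Num.min r0 (Num.min (rho1 / 10) (delta / 10)).
  have r_gt0 : 0 < r by rewrite !lt_min r00 !divr_gt0.
  have : r <= r by [].
  rewrite {2}/r !le_min => /andP[rr0 /andP[rrho rdelta]].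
  exists (5 * r); first by rewrite mulr_gt0//=; lra.
  have -> : (kappa / 2 / (24 * m.+1%:R) / 5) ^+ m * (5 * r) ^+ m =
      (kappa * r / 2 / (24 * m.+1%:R)) ^+ m.
    by rewrite -exprMn; congr (_ ^+ _); field; rewrite gt_eqF.
  apply: (@accessible_density Z x kappa r0 rho1 r) => //; last by lra.
  by move=> ? [].
have /choice[f fP] (N : nat) : exists f : 'rV[R]_m -> 'rV[R]_m.+1,
    (exists L', forall p q, enorm (f p - f q) <= L' * enorm (p - q)) /\
    piece_ N `<=` range f.
  rewrite /piece_; case: unpickle => [[[q k] c]|] /=; last first.
    by apply: (@cone_free_lipschitz _ _ _ 0 1).
  apply: (@cone_free_lipschitz _ _ _ (map_mx ratr q) k.+1%:R^-1); first by rewrite invr_gt0.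
  (* Two points of a ball of radius [1 / (2 (k + 1))] are within the reach [1 / (k + 1)] of
     accessibility. *)
  move=> x y [Ex accx xc] [Ey _ yc]; apply: accx => //.
  move: xc yc; rewrite -!ball_normE /=.
  have := ler_distD (map_mx ratr c) y x; rewrite (distrC y (map_mx _ _)).
  by move: (k.+1%:R^-1 : R) => d; lra.
exists f; split; first by move=> N; have [] := fP N.
apply: subset_hausdorff0 Z0 => x [Ex nf]; split => // -[N _ xN]; apply: nf.
by exists N => //; have [_] := fP N; apply.
Qed.

End TwoSidedBoundary.

(** * Corkscrew domains *)

Section Corkscrew.
Context {R : realType} {n : nat}.
Local Notation T := 'rV[R]_n.

(** Otherwise a segment from [a] would meet the boundary too early. The factor [n.+1] passes from
    Euclidean distance to sup-norm balls. *)
Lemma ball_sub_of_set_dist (W : set T) (a : T) (rho : R) : open W -> W a ->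
  rho < set_dist [set a] (boundary W) -> ball a (rho / n.+1%:R) `<=` W.
Proof.
move=> oW Wa ad z; rewrite -ball_normE /= => az; apply: contrapT => nWz.
have [|u /andP[u0 u1] [[cu nu] _]] := last_exit oW ler01 Wa (v := z - a).
  by rewrite scale1r addrC subrK.
set p := a + _ in cu nu.
have : set_dist [set a] (boundary W) <= enorm (a - p).
  apply: ge_inf; first by exists 0 => _ [x _ [y _ <-]]; exact: sqrtr_ge0.
  by exists a => //; exists p => //; split => // /interior_subset.
apply/negP; rewrite -ltNge; apply: le_lt_trans ad.
rewrite (le_trans (enorm_le_norm _))// opprD addNKr -scalerN normrZ opprB (gtr0_norm u0).
move: az; rewrite ltr_pdivlMr// => az.
apply: le_trans (ltW az); rewrite mulrC ler_pM ?mulr_ge0 ?(ltW u0)//.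
  by rewrite ler_piMl.
by rewrite ler_nat.
Qed.

Lemma boundary_exterior (W : set T) :
  boundary (exterior W) = closure (exterior W) `\` exterior W.
Proof. by rewrite /boundary ((interior_id _).1 (open_interior _)). Qed.

Lemma boundary_exterior_sub (W : set T) : open W ->
  boundary (exterior W) `<=` boundary W.
Proof.
move=> oW x; rewrite boundary_exterior => -[cx nx]; split.
  by move: nx; rewrite /exterior interiorC => /contrapT.
move=> /interior_subset Wx; have [y [/interior_subset]] := cx W (open_nbhs_nbhs (conj oW Wx)).
by [].
Qed.

Lemma compact_closed_ball (x : T) (r : R) : 0 < r -> compact (closed_ball x r).
Proof.
move=> r0; apply: bounded_closed_compact; last exact: closed_ball_closed.
exists (`|x| + r); split; [exact: num_real|move=> M Mx y].
by rewrite closed_ballE// /closed_ball_ /=; have := ler_normB x (x - y); rewrite subKr; lra.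
Qed.

(** Boundary points of the exterior are boundary points of [W], so both corkscrew conditions apply
    at them, with the compact set [closed_ball x 1]. *)
Lemma two_sided_of_corkscrew (W : set T) (x : T) : open W ->
  corkscrew W -> corkscrew (exterior W) -> exists kappa r0 rho1 : R,
    [/\ 0 < kappa <= 1, 0 < r0, 0 < rho1 & forall y, boundary (exterior W) y ->
      `|y - x| < rho1 -> forall r, 0 < r <= r0 -> exists a b,
        [/\ `|a - y| <= r, `|b - y| <= r, ball a (kappa * r) `<=` exterior W &
          ball b (kappa * r) `<=` ~` exterior W]].
Proof.
move=> oW cW cU; pose K : set T := closed_ball x 1.
have cK : compact K by exact: compact_closed_ball.
(* The radius bound of a corkscrew condition may be infinite; a positive real below it is enough. *)
have real_le (r0 : \bar R) : (0 < r0)%E -> exists2 r : R, 0 < r & (r%:E <= r0)%E.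
  by case: r0 => [r r0|_|//]; [exists r|exists 1 => //; rewrite leey].
have [M1 [R1 [M11 /real_le[r1 r10 rR1] _ ck1]]] := cW K cK.
have [M2 [R2 [M21 /real_le[r2 r20 rR2] _ ck2]]] := cU K cK.
pose M := Num.max M1 M2.
have Mge1 : 1 <= M by rewrite le_max (ltW M11).
have M0 : 0 < M by apply: lt_le_trans Mge1.
exists ((M * n.+1%:R)^-1), (Num.min r1 r2), 1; split => //.
- rewrite invr_gt0 mulr_gt0//= invf_le1 ?mulr_gt0//.
  by rewrite mulr_ege1// ler1n.
- by rewrite lt_min r10.
move=> y Ey yx r /andP[r0]; rewrite le_min => /andP[rr1 rr2].
have Ky : K y by rewrite /K closed_ballE// /closed_ball_ /= distrC ltW.
have sub (M' : R) : 1 < M' -> M' <= M -> (M * n.+1%:R)^-1 * r <= M'^-1 * r / n.+1%:R.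
  move=> M'1 M'M; rewrite invfM [leRHS]mulrAC -!mulrA.
  rewrite ler_wpM2r ?mulr_ge0 ?invr_ge0 ?(ltW r0)// lef_pV2 ?posrE//.
  by rewrite (lt_trans ltr01).
have [|b Wb [_ bQ db]] := ck1 y r (boundary_exterior_sub oW Ey) Ky r0.
  by apply: le_trans rR1; rewrite lee_fin.
have [|a Ua [_ aQ da]] := ck2 y r Ey Ky r0.
  by apply: le_trans rR2; rewrite lee_fin.
exists a, b; split.
- by rewrite (le_trans (norm_le_enorm _))// ltW.
- by rewrite (le_trans (norm_le_enorm _))// ltW.
- apply: subset_trans (ball_sub_of_set_dist _ Ua da); last exact: open_interior.
  by apply: le_ball; apply: sub => //; rewrite le_max lexx orbT.
- apply: (@subset_trans _ W); last by move=> z Wz /interior_subset.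
  apply: subset_trans (ball_sub_of_set_dist oW Wb db).
  by apply: le_ball; apply: sub => //; rewrite le_max lexx.
Qed.

Lemma continuous_enorm : continuous (@enorm R n).
Proof.
move=> x; apply: continuous_comp; last exact: sqrt_continuous.
move: x; apply: continuous_big => [|i _ x].
  exact: add_continuous.
under eq_fun do rewrite expr2.
by apply: continuousM; exact: coord_continuous.
Qed.

Lemma measurable_eball (x : T) (r : R) : measurable (eball x r).
Proof.
apply: open_measurable_rV.
rewrite (_ : eball x r = (fun y => y - x) @^-1` (@enorm R n @^-1` [set s | s < r]))//.
apply: open_comp => [y _|].
  have F := nbhs_filter y.
  by apply: (@cvgB _ _ _ (nbhs y) F id (fun=> x)); [exact: cvg_id|exact: cvg_cst].
by apply: open_comp; [move=> y _; exact: continuous_enorm|exact: open_lt].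
Qed.

End Corkscrew.

(** * Limits of the ratio of the two harmonic measures *)

Section HarmonicRatio.
Context {R : realType} {n : nat}.
Local Notation T := 'rV[R]_n.
Variables (Omega : set T) (wp wm : {measure set T -> \bar R}).

Lemma ratio_ge0 (Q : T) (r : R) : (0 <= Defs.ratio wp wm Q r)%E.
Proof. by rewrite mule_ge0 ?inve_ge0 ?measure_ge0. Qed.

(** A limit of the nonnegative ratio is 0, positive and finite, or infinite: [Lambda3], [Lambda1],
    [Lambda2]. Without a limit the point is in [Lambda4]. *)
Lemma boundary_decomposition :
  boundary Omega = Gamma_star Omega wp wm
    `|` singular_part Omega wp wm `|` null_part Omega wp wm.
Proof.
apply/seteqP; split => Q; last first.
  by move=> [[[[[]]]|[[]|[]]]|[[[]]|[]]].
move=> bQ; have [[l Ql]|noL] :=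
  pselect (exists l : \bar R, Defs.ratio wp wm Q r @[r --> 0^'+] --> l).
  have l0 : (0 <= l)%E.
    by apply: (cvge_ge _ Ql); apply: nearW => r; exact: ratio_ge0.
  case: l l0 Ql => [l l0 Ql|_ Ql|//]; last by left; right; left.
  move: l0; rewrite lee_fin le_eqVlt => /orP[/eqP l0|l0].
    by left; right; right; split => //; move: Ql; rewrite -l0.
  have L1 : Lambda1 Omega wp wm Q by split => //; exists l.
  by have [?|?] := pselect (Gamma_star Omega wp wm Q); [left; left|right; left].
by right; right.
Qed.

(* Off the closure of the exterior domain, small balls are [wm]-null, so the
   ratio tends to 0 there. *)
Lemma Lambda1_sub_boundary_exterior : open Omega ->
  wm (~` boundary (exterior Omega)) = 0%E ->
  Lambda1 Omega wp wm `<=` boundary (exterior Omega).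
Proof.
move=> oO wm0 Q [bQ [l l0 Ql]]; rewrite boundary_exterior; split; last first.
  rewrite /exterior interiorC => ncQ; case: bQ => cQ _; exact: ncQ.
apply: contrapT => ncQ.
have oC : open (~` closure (exterior Omega)) by exact/closed_openC/closed_closure.
have /nbhs_ballP[e /= e0 eC] := open_nbhs_nbhs (conj oC ncQ).
have mB : measurable (~` boundary (exterior Omega)).
  rewrite boundary_exterior setCD; apply: measurableU.
    exact: open_measurable_rV.
  by apply: open_measurable_rV; exact: open_interior.
have r0 : Defs.ratio wp wm Q r @[r --> 0^'+] --> 0%E.
  apply: cvg_near_cst; near=> r.
  (* A zero numerator gives the quotient 0 even if [wp] vanishes on the ball. *)
  rewrite /Defs.ratio (_ : wm (eball Q r) = 0%E) ?mul0e//.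
  apply/eqP; rewrite eq_le measure_ge0 andbT -wm0.
  apply: le_measure; rewrite ?inE//; first exact: measurable_eball.
  move=> y yr [cy _]; apply: (eC y) => //; rewrite -ball_normE /= distrC.
  apply: le_lt_trans (norm_le_enorm _) _; apply: lt_le_trans yr _.
  by near: r; exact: nbhs_right_le.
have l00 : l%:E = 0%:E by apply: (cvg_unique _ Ql r0); exact: ereal_hausdorff.
by move: l0; rewrite [l](congr1 fine l00) ltxx.
Unshelve. all: by end_near. Qed.

End HarmonicRatio.

Theorem theorem4p2 (R : realType) (n : nat) (n_ge3 : (3 <= n)%N)
    (Omega : set 'rV[R]_n)
    (Omega_NTA : two_sided_locally_NTA_domain Omega)
    (radon_boundary : radon (mrestriction (hausdorff n.-1) (boundary Omega)))
    (Xp Xm : 'rV[R]_n) (Omega_Xp : Omega Xp) (Omega_Xm : exterior Omega Xm)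
    (wp wm : {measure set 'rV[R]_n -> \bar R})
    (wpP : is_harmonic_measure Omega Xp wp)
    (wmP : is_harmonic_measure (exterior Omega) Xm wm) :
  boundary Omega = Gamma_star Omega wp wm
                     `|` singular_part Omega wp wm `|` null_part Omega wp wm
  /\ rectifiable n.-1 (Gamma_star Omega wp wm).
Proof.
split; first exact: boundary_decomposition.
have [[[oO _ _] cO cU _] _] := Omega_NTA.
have [_ wm0 _] := wmP.
have GE : Gamma_star Omega wp wm `<=` boundary (exterior Omega).
  move=> Q [[L1 _ _] _]; exact: Lambda1_sub_boundary_exterior oO wm0 Q L1.
case: n n_ge3 Omega Omega_NTA radon_boundary Xp Xm Omega_Xp Omega_Xm wp wm wpP wmP
  oO cO cU wm0 GE => [//|m] m_ge2 Omega _ radon_boundary _ _ _ _ wp wm _ _ oO cO cU _ GE.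
have m_gt0 : (0 < m)%N by rewrite -ltnS (ltnW m_ge2).
rewrite /= in radon_boundary *.
set mu := mrestriction _ _ in radon_boundary.
have [[mu0 _] mu_sadd mu_fin _ mu_outer] := radon_boundary.
have mu_ge0 X : (0 <= mu X)%E by exact: hausdorff_ge0.
(* The Radon hypothesis supplies the countable additivity on Borel sets that makes [mu] a
   measure. *)
pose sigma : {measure set 'rV[R]_m.+1 -> \bar R} :=
  HB.pack mu (isMeasure.Build _ _ _ mu mu0 mu_ge0 mu_sadd).
have mu_le X Y : X `<=` Y -> (mu X <= mu Y)%E.
  by move=> XY; apply: subset_hausdorff; exact: setSI.
have mu_ball (x : 'rV[R]_m.+1) (r : R) : (mu (ball x r) < +oo)%E.
  have r1 : 0 < Num.max r 1 by rewrite lt_max ltr01 orbT.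
  have cfin := mu_fin _ (compact_closed_ball (x := x) r1).
  apply: (@le_lt_trans _ _ (mu (closed_ball x (Num.max r 1)))) => //; apply: mu_le.
  apply: subset_trans (@subset_closed_ball _ _ _ _).
  by apply: le_ball; rewrite le_max lexx.
have outer (A : set 'rV[R]_m.+1) (eps : R) : measurable A -> bounded_set A ->
    0 < eps -> exists W, [/\ open W, A `<=` W & (sigma (W `\` A) <= eps%:E)%E].
  move=> mA [M [Mr MA]] eps0.
  (* Finiteness of [mu A] turns outer regularity into a bound on the mass of [W] off [A]. *)
  have fA : mu A \is a fin_num.
    rewrite ge0_fin_numE//; apply: le_lt_trans (mu_ball 0 (M + 2)); apply: mu_le => x Ax.
    have := MA (M + 1) _ x Ax; rewrite ltrDl ltr01 => /(_ isT).
    by rewrite -ball_normE /= sub0r normrN; lra.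
  have /(lb_ereal_inf_adherent eps0) : ereal_inf [set mu U | U in
      [set U | open U /\ A `<=` U]] \is a fin_num by rewrite -mu_outer.
  rewrite -mu_outer// => -[_ [W [oW AW] <-] Weps]; exists W; split => //.
  rewrite measureD//; last 2 first.
  - exact: open_measurable_rV.
  - by apply: lt_le_trans Weps _; rewrite leey.
  rewrite setIidr//; apply: ltW; rewrite lteBlDl//.
have [f [fL f0]] : rectifiable m (closure (exterior Omega) `\` exterior Omega).
  apply: (@rectifiable_two_sided R m m_gt0 (exterior Omega) sigma) => //.
  - exact: open_interior.
  (* [sigma] is carried by the boundary of [Omega], which contains that of the exterior; hence an
     inequality. *)
  - move=> X mX; apply: subset_hausdorff; apply: setIS.
    by rewrite -boundary_exterior; exact: boundary_exterior_sub.
  - move=> x _; have [kappa [r0 [rho1 [? ? ? tx]]]] := two_sided_of_corkscrew x oO cO cU.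
    exists kappa, r0, rho1; split => // y Ey yx; apply: tx => //.
    by rewrite boundary_exterior.
exists f; split => //; apply: subset_hausdorff0 f0; apply: setSD.
by rewrite -boundary_exterior.
Qed.
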